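(* Let $\zeta:\mathbb{R}^+\to\mathbb{R}^+$ be an unbounded monotone increasing function. Then there exists an effective reduced divisor $D$ on $\mathbb{C}$ such that: (1) for every $r\in\mathbb{R}^+$ the inequality $\deg(D_r)\le\zeta(r)$ holds, where $D_r$ denotes the restriction of $D$ to the open disc $\{z\in\mathbb{C}:|z|<r\}$; and (2) there is no Brody entire function $f$ for which $D$ is the zero divisor.
   Context: $\mathbb{R}^+$ denotes the positive real numbers. For an entire function $f$ the spherical derivative is $f^\#(z)=\frac{|f'(z)|}{1+|f(z)|^2}$; $f$ is called Brody if $f^\#$ is bounded on $\mathbb{C}$. An effective reduced divisor on $\mathbb{C}$ is a closed discrete subset of $\mathbb{C}$, each point being counted with multiplicity one; $\deg(D_r)$ is the number of points of $D$ in the open disc of radius $r$ centered at $0$. The zero divisor of a not identically vanishing entire function is its set of zeros counted with multiplicity; so $D$ being the zero divisor of $f$ means that the zeros of $f$ are exactly the points of $D$ and all of them are simple. *)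

(* Defs.v *)
From Stdlib Require Import Reals List.
From Coquelicot Require Import Coquelicot.
Open Scope R_scope.

(* [K] and [V] are given explicitly: [ex_derive] on maps C -> C must be read
   as complex differentiability, not as a derivative over R. *)
Definition entire (f : C -> C) : Prop :=
  forall z : C, @ex_derive C_AbsRing C_NormedModule f z.

(* [C_derive f z] is total; it is the complex derivative f'(z) wherever f is
   complex differentiable, by [is_C_derive_unique]. *)
Definition spherical_derivative (f : C -> C) (z : C) : R :=
  Cmod (C_derive f z) / (1 + (Cmod (f z)) ^ 2).

Definition brody (f : C -> C) : Prop :=
  exists M : R, forall z : C, spherical_derivative f z <= M.

(* An effective reduced divisor is encoded by its support: every point of the
   set has multiplicity one. *)
Definition reduced_divisor (D : C -> Prop) : Prop :=
  @closed C_UniformSpace D /\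
  forall z : C, D z ->
    exists eps : R, 0 < eps /\
      forall w : C, D w -> Cmod (w - z)%C < eps -> w = z.

(* [degree D r n]: D has finitely many points in the disc |z| < r, namely n. *)
Definition degree (D : C -> Prop) (r : R) (n : nat) : Prop :=
  exists l : list C, NoDup l /\ length l = n /\
    forall z : C, In z l <-> (D z /\ Cmod z < r).

Definition C_derive_n (f : C -> C) (k : nat) : C -> C := Nat.iter k C_derive f.

Definition vanishing_order (f : C -> C) (z : C) (m : nat) : Prop :=
  (forall k : nat, (k < m)%nat -> C_derive_n f k z = RtoC 0) /\
  C_derive_n f m z <> RtoC 0.

(* Order 1 at the points of D and order 0 elsewhere.  In particular f does not
   vanish identically, since the zero function has no order at any point. *)
Definition is_zero_divisor (f : C -> C) (D : C -> Prop) : Prop :=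
  forall z : C,
    (D z -> vanishing_order f z 1) /\ (~ D z -> vanishing_order f z 0).

(* Main.v *)
Require Import Defs.
From Stdlib Require Import Reals List.
From Stdlib Require Import Lra Lia Psatz ClassicalEpsilon.
From Coquelicot Require Import Coquelicot.
Open Scope R_scope.

(** The divisor is D = {x_k, -x_k : k in nat}, where 1 <= x_0 and the x_k grow so
    fast that 4 x_k^2 <= x_(k+1) and 2 (k + 1) <= zeta(x_k); the second condition
    gives the degree bound.  Suppose that f is entire with |f'| <= M (1 + |f|^2)
    and has D as zero divisor.

    First, f has exponential type.  If |f(z0)| > 1, let rho be the distance from
    z0 to the set where |f| <= 1; it is at most the distance to any zero of f.
    On the disc of radius rho the function ln |f| is positive and harmonic, so
    Harnack's inequality makes it grow at least linearly, with slope comparable to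
    ln |f(z0)| / rho, as one enters the disc from its boundary.  The bound on the
    spherical derivative limits this slope near a boundary point where |f| <= 1,
    and ln |f(z0)| <= 32 M rho follows ([brody_exponential_type]).

    Next, let f = P_n q where P_n is the product of the 1 - z^2 / x_k^2 for k <= n.
    The quotient q is entire, q(0) = f(0), and q has no zero in the disc of radius
    x_(n+1).  On the circle of radius r = x_(n+1) / 2 one has |P_n| >= 1, hence
    ln |q| <= 64 M r.  The harmonic function 64 M r - ln |q| is therefore
    nonnegative there.  Adding the Poisson formulas at z and -z cancels the
    term of first order in |z| / r, so the sum of its values at x_n and -x_n exceeds
    twice its value at 0 by at most a multiple of (x_n / r)^2 (r + 1), which is bounded
    since r >= 2 x_n^2 ([harnack_symmetric], [quotient_lower_bound]).  Hence
    |q(x_n) q(-x_n)| is bounded below independently of n.  The symmetry of D is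
    what makes a factor e^(a z) of f harmless.

    Finally f'(x_n) and f'(-x_n) have modulus 2 |P_(n-1)(x_n)| / x_n times |q(x_n)|
    and |q(-x_n)|, and |P_(n-1)(x_n)| >= x_n^2 / (2 x_0^2).  Both moduli are at
    most M because f vanishes there, so |q(x_n) q(-x_n)| tends to 0: a
    contradiction.

    The complex analysis behind this is developed from complex differentiability
    alone: Goursat's theorem for triangles ([goursat]), primitives on discs, also
    for functions that are only continuous at one point ([primitive_punctured]),
    Cauchy's formula, differentiability of the derivative, logarithms of
    zero-free functions ([re_holomorphic_ln_Cmod]), and the Poisson formula. *)

(** * Complex derivatives and continuity in epsilon-delta form *)

Notation cderiv := (@is_derive C_AbsRing C_NormedModule) (only parsing).
Notation ccont := (@continuous C_UniformSpace C_UniformSpace) (only parsing).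
Notation pderiv := (@is_derive R_AbsRing C_R_NormedModule) (only parsing).
Notation pcont := (@continuous R_UniformSpace C_UniformSpace) (only parsing).

(** The filter in the definition of [is_derive] ranges over all limit points of
    [locally x], but such a limit point can only be [x]. *)
Lemma is_derive_eps {K : AbsRing} {V : NormedModule K} (f : K -> V) (x : K) (l : V) :
  is_derive f x l <->
  forall eps : posreal, locally x (fun y =>
    norm (minus (minus (f y) (f x)) (scal (minus y x) l)) <= eps * norm (minus y x)).
Proof.
  split.
  - intros [_ H] eps. apply (H x). now intros P HP.
  - intros H. split. apply is_linear_scal_l.
    intros y Hy.
    replace y with x; [exact H|].
    exact (is_filter_lim_locally_unique x y Hy).
Qed.

Lemma cderiv_eps (f : C -> C) (z l : C) :
  cderiv f z l <->
  forall eps, 0 < eps -> exists d, 0 < d /\ forall w : C, Cmod (w - z) < d ->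
    Cmod (f w - f z - l * (w - z)) <= eps * Cmod (w - z).
Proof.
  rewrite is_derive_eps. split.
  - intros H eps He. destruct (H (mkposreal eps He)) as [d Hd].
    exists d. split. apply cond_pos. intros w Hw. specialize (Hd w Hw).
    rewrite (Cmult_comm l). exact Hd.
  - intros H eps. destruct (H eps (cond_pos eps)) as [d [d0 Hd]].
    exists (mkposreal d d0). intros w Hw. specialize (Hd w Hw).
    rewrite (Cmult_comm l) in Hd. exact Hd.
Qed.

(** The uniform structures on C as a product of two lines and as a valued ring are
    equivalent but not convertible; derivatives do not see the difference. *)
Lemma cderiv_AbsRing (f : C -> C) (z l : C) :
  cderiv f z l <-> @is_derive C_AbsRing (AbsRing_NormedModule C_AbsRing) f z l.
Proof. rewrite !is_derive_eps. reflexivity. Qed.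

Lemma Cmod_prod_norm (z : C) : @norm R_AbsRing C_R_NormedModule z = Cmod z.
Proof. symmetry. apply Cmod_norm. Qed.

Lemma pderiv_eps (g : R -> C) (t : R) (l : C) :
  pderiv g t l <->
  forall eps, 0 < eps -> exists d, 0 < d /\ forall s : R, Rabs (s - t) < d ->
    Cmod (g s - g t - RtoC (s - t) * l) <= eps * Rabs (s - t).
Proof.
  rewrite is_derive_eps. split.
  - intros H eps He. destruct (H (mkposreal eps He)) as [d Hd].
    exists d. split. apply cond_pos. intros w Hw. specialize (Hd w Hw).
    rewrite Cmod_prod_norm, scal_R_Cmult in Hd. exact Hd.
  - intros H eps. destruct (H eps (cond_pos eps)) as [d [d0 Hd]].
    exists (mkposreal d d0). intros w Hw. specialize (Hd w Hw).
    rewrite Cmod_prod_norm, scal_R_Cmult. exact Hd.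
Qed.

Lemma locally_Cmod (z : C) (P : C -> Prop) :
  @locally C_UniformSpace z P <-> exists d, 0 < d /\ forall w : C, Cmod (w - z) < d -> P w.
Proof.
  rewrite locally_C. split.
  - intros [d H]. exists d. split. apply cond_pos. exact H.
  - intros [d [d0 H]]. exists (mkposreal d d0). exact H.
Qed.

Lemma ccont_eps (f : C -> C) (z : C) :
  ccont f z <->
  forall eps, 0 < eps -> exists d, 0 < d /\ forall w : C, Cmod (w - z) < d ->
    Cmod (f w - f z) < eps.
Proof.
  split.
  - intros H eps He.
    assert (L : @locally C_UniformSpace (f z) (fun y => Cmod (y - f z) < eps)).
    { apply locally_Cmod. exists eps. now split. }
    apply H in L. now apply locally_Cmod in L.
  - intros H P HP. apply locally_Cmod in HP. destruct HP as [e [e0 HP]].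
    apply locally_Cmod. destruct (H e e0) as [d [d0 Hd]].
    exists d. split; [exact d0|]. intros w Hw. now apply HP, Hd.
Qed.

Lemma cderiv_cont (f : C -> C) (z l : C) : cderiv f z l -> ccont f z.
Proof.
  rewrite cderiv_eps, ccont_eps. intros H eps He.
  destruct (H 1 Rlt_0_1) as [d [d0 Hd]].
  assert (Hl := Cmod_ge_0 l).
  exists (Rmin d (eps / (2 + Cmod l))). split.
  - apply Rmin_pos; [easy|]. apply Rdiv_lt_0_compat; lra.
  - intros w Hw.
    assert (H1 := Rlt_le_trans _ _ _ Hw (Rmin_l _ _)).
    assert (H2 := Rlt_le_trans _ _ _ Hw (Rmin_r _ _)).
    specialize (Hd w H1).
    replace (f w - f z)%C with ((f w - f z - l * (w - z)) + l * (w - z))%C by ring.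
    eapply Rle_lt_trans; [apply Cmod_triangle|]. rewrite Cmod_mult.
    apply Rlt_div_r in H2; [|lra].
    assert (0 <= Cmod (w - z)) by apply Cmod_ge_0. nra.
Qed.

Lemma cderiv_ext_loc (f g : C -> C) (z l : C) (d : R) : 0 < d ->
  (forall w : C, Cmod (w - z) < d -> f w = g w) -> cderiv f z l -> cderiv g z l.
Proof.
  intros d0 E. apply is_derive_ext_loc. exists (mkposreal d d0). exact E.
Qed.

Lemma cderiv_eq (f : C -> C) (z l l' : C) : cderiv f z l -> l = l' -> cderiv f z l'.
Proof. now intros H <-. Qed.

Lemma cderiv_const (a z : C) : cderiv (fun _ => a) z (RtoC 0).
Proof. apply (is_derive_const (K := C_AbsRing) (V := C_NormedModule)). Qed.

Lemma cderiv_id (z : C) : cderiv (fun w => w) z (RtoC 1).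
Proof. apply cderiv_AbsRing, (is_derive_id (K := C_AbsRing)). Qed.

Lemma cderiv_plus (f g : C -> C) (z a b : C) : cderiv f z a -> cderiv g z b ->
  cderiv (fun w => f w + g w)%C z (a + b)%C.
Proof. apply (is_derive_plus (K := C_AbsRing) (V := C_NormedModule)). Qed.

Lemma cderiv_minus (f g : C -> C) (z a b : C) : cderiv f z a -> cderiv g z b ->
  cderiv (fun w => f w - g w)%C z (a - b)%C.
Proof. apply (is_derive_minus (K := C_AbsRing) (V := C_NormedModule)). Qed.

Lemma cderiv_mult (f g : C -> C) (z a b : C) : cderiv f z a -> cderiv g z b ->
  cderiv (fun w => f w * g w)%C z (a * g z + f z * b)%C.
Proof.
  rewrite !cderiv_AbsRing. intros Hf Hg.
  exact (is_derive_mult (K := C_AbsRing) f g z a b Hf Hg Cmult_comm).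
Qed.

Lemma cderiv_shift (a z : C) : cderiv (fun w => w - a)%C z (RtoC 1).
Proof.
  apply (cderiv_eq _ _ (RtoC 1 - RtoC 0)%C); [|ring].
  exact (cderiv_minus (fun w => w) (fun _ => a) z _ _ (cderiv_id z) (cderiv_const a z)).
Qed.

Lemma cderiv_scal (k : C) (f : C -> C) (z a : C) : cderiv f z a ->
  cderiv (fun w => k * f w)%C z (k * a)%C.
Proof.
  intros H. replace (k * a)%C with (RtoC 0 * f z + k * a)%C by ring.
  apply (cderiv_mult (fun _ => k) f); [apply cderiv_const|exact H].
Qed.

Lemma cderiv_Cinv (z : C) : z <> RtoC 0 -> cderiv Cinv z (- / (z * z))%C.
Proof.
  intros Hz. apply cderiv_eps. intros eps He.
  assert (m0 : 0 < Cmod z) by now apply Cmod_gt_0.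
  set (m := Cmod z) in *.
  (* m / 2 keeps |w| above m / 2; then the error is |w - z|^2 / (|z|^2 |w|) *)
  exists (Rmin (m / 2) (eps * m ^ 3 / 2)). split.
  { apply Rmin_pos; [lra|]. assert (0 < m ^ 3) by now apply pow_lt. nra. }
  intros w Hw.
  assert (H1 := Rlt_le_trans _ _ _ Hw (Rmin_l _ _)).
  assert (H2 := Rlt_le_trans _ _ _ Hw (Rmin_r _ _)).
  assert (W : m / 2 < Cmod w).
  { assert (T := Cmod_triangle w (z - w)).
    replace (w + (z - w))%C with z in T by ring. fold m in T.
    replace (z - w)%C with (- (w - z))%C in T by ring. rewrite Cmod_opp in T. lra. }
  assert (w0 : w <> RtoC 0) by (apply Cmod_gt_0; lra).
  replace (/ w - / z - - / (z * z) * (w - z))%C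
    with ((w - z) * ((w - z) * / (z * z * w)))%C by (field; auto).
  rewrite !Cmod_mult, Rmult_comm.
  apply Rmult_le_compat_r; [apply Cmod_ge_0|].
  rewrite Cmod_inv by (repeat apply Cmult_neq_0; auto).
  rewrite !Cmod_mult. fold m.
  assert (P : 0 < m * m * Cmod w) by (repeat apply Rmult_lt_0_compat; lra).
  apply Rle_div_l; [lra|].
  apply Rle_trans with (eps * (m * m * (m / 2))).
  - lra.
  - apply Rmult_le_compat_l; [lra|]. apply Rmult_le_compat_l; nra.
Qed.

Lemma cderiv_comp (f g : C -> C) (z a b : C) :
  cderiv f (g z) a -> cderiv g z b -> cderiv (fun w => f (g w)) z (b * a)%C.
Proof.
  rewrite (cderiv_AbsRing g).
  apply (is_derive_comp (K := C_AbsRing) (V := C_NormedModule)).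
Qed.

Lemma cderiv_inv (f : C -> C) (z a : C) : cderiv f z a -> f z <> RtoC 0 ->
  cderiv (fun w => / f w)%C z (- a / (f z * f z))%C.
Proof.
  intros Hf H0.
  replace (- a / (f z * f z))%C with (a * - / (f z * f z))%C by (field; auto).
  apply (cderiv_comp Cinv f); [now apply cderiv_Cinv|exact Hf].
Qed.

Lemma cderiv_div (f g : C -> C) (z a b : C) : cderiv f z a -> cderiv g z b ->
  g z <> RtoC 0 -> cderiv (fun w => f w / g w)%C z ((a * g z - f z * b) / (g z * g z))%C.
Proof.
  intros Hf Hg H0.
  replace ((a * g z - f z * b) / (g z * g z))%C
    with (a * / g z + f z * (- b / (g z * g z)))%C by (field; auto).
  apply (cderiv_mult f (fun w => / g w)%C); [exact Hf|now apply cderiv_inv].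
Qed.

Lemma cderiv_correct (f : C -> C) (z : C) :
  @ex_derive C_AbsRing C_NormedModule f z -> cderiv f z (C_derive f z).
Proof. intros H. exact (C_derive_correct f z (RtoC 0) H). Qed.

(** The chain rule for a real path followed by a holomorphic map: the two derivatives
    live over different fields, so neither the real nor the complex chain rule applies. *)
Lemma pderiv_comp (f : C -> C) (g : R -> C) (t : R) (a b : C) :
  cderiv f (g t) a -> pderiv g t b -> pderiv (fun s => f (g s)) t (a * b)%C.
Proof.
  rewrite cderiv_eps, !pderiv_eps. intros Hf Hg eps He.
  assert (Ha := Cmod_ge_0 a). assert (Hb := Cmod_ge_0 b).
  (* |g s - g t| <= (|b| + 1) |s - t| near t *)
  destruct (Hf (eps / (2 * (Cmod b + 1)))) as [d1 [d10 H1]].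
  { apply Rdiv_lt_0_compat; lra. }
  destruct (Hg 1 Rlt_0_1) as [d2 [d20 H2]].
  destruct (Hg (eps / (2 * (Cmod a + 1)))) as [d3 [d30 H3]].
  { apply Rdiv_lt_0_compat; lra. }
  exists (Rmin (d1 / (Cmod b + 1)) (Rmin d2 d3)). split.
  { repeat apply Rmin_pos; try easy. apply Rdiv_lt_0_compat; lra. }
  intros s Hs.
  assert (S1 := Rlt_le_trans _ _ _ Hs (Rmin_l _ _)).
  assert (S23 := Rlt_le_trans _ _ _ Hs (Rmin_r _ _)).
  assert (S2 := Rlt_le_trans _ _ _ S23 (Rmin_l _ _)).
  assert (S3 := Rlt_le_trans _ _ _ S23 (Rmin_r _ _)).
  specialize (H2 s S2). specialize (H3 s S3).
  assert (G : Cmod (g s - g t) <= (Cmod b + 1) * Rabs (s - t)).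
  { replace (g s - g t)%C with ((g s - g t - RtoC (s - t) * b) + RtoC (s - t) * b)%C by ring.
    eapply Rle_trans; [apply Cmod_triangle|]. rewrite Cmod_mult, Cmod_R. lra. }
  apply Rlt_div_r in S1; [|lra].
  assert (X : Cmod (g s - g t) < d1) by lra.
  specialize (H1 _ X).
  replace (f (g s) - f (g t) - RtoC (s - t) * (a * b))%C with
    ((f (g s) - f (g t) - a * (g s - g t)) + a * (g s - g t - RtoC (s - t) * b))%C by ring.
  eapply Rle_trans; [apply Cmod_triangle|]. rewrite Cmod_mult.
  assert (A1 : Cmod (f (g s) - f (g t) - a * (g s - g t)) <= eps / 2 * Rabs (s - t)).
  { eapply Rle_trans; [exact H1|].
    replace (eps / 2 * Rabs (s - t)) with
      (eps / (2 * (Cmod b + 1)) * ((Cmod b + 1) * Rabs (s - t))) by (field; lra).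
    apply Rmult_le_compat_l; [|exact G]. apply Rlt_le, Rdiv_lt_0_compat; lra. }
  assert (A2 : Cmod a * Cmod (g s - g t - RtoC (s - t) * b) <= eps / 2 * Rabs (s - t)).
  { replace (eps / 2 * Rabs (s - t)) with
      ((Cmod a + 1) * (eps / (2 * (Cmod a + 1)) * Rabs (s - t))) by (field; lra).
    apply Rmult_le_compat; try apply Cmod_ge_0; try lra. }
  lra.
Qed.

Lemma pderiv_pair (g : R -> C) (t a b : R) :
  is_derive (fun s => fst (g s)) t a -> is_derive (fun s => snd (g s)) t b ->
  pderiv g t (a, b).
Proof.
  intros Ha Hb.
  apply (filterdiff_ext (K := R_AbsRing) (fun s => (fst (g s), snd (g s)))).
  { intros s. now destruct (g s). }
  apply (filterdiff_ext_lin _ (fun y : R => (scal y a, scal y b))).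
  - apply (filterdiff_comp'_2 (K := R_AbsRing) (fun s => fst (g s)) (fun s => snd (g s))
      (fun u v => (u, v)) t (fun y => scal y a) (fun y => scal y b) (fun u v => (u, v)) Ha Hb).
    apply (filterdiff_ext (fun p => p)); [now intros [u v]|].
    apply (filterdiff_ext_lin _ (fun p => p)); [|now intros [u v]].
    apply filterdiff_id.
  - reflexivity.
Qed.

Lemma pderiv_fst (g : R -> C) (t : R) (l : C) : pderiv g t l ->
  is_derive (fun s => fst (g s)) t (fst l).
Proof.
  intros H. 
  apply (filterdiff_comp' (K := R_AbsRing) g fst t (fun y => scal y l) fst H).
  apply filterdiff_linear, is_linear_fst.
Qed.

Lemma pderiv_snd (g : R -> C) (t : R) (l : C) : pderiv g t l ->
  is_derive (fun s => snd (g s)) t (snd l).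
Proof.
  intros H. 
  apply (filterdiff_comp' (K := R_AbsRing) g snd t (fun y => scal y l) snd H).
  apply filterdiff_linear, is_linear_snd.
Qed.

Lemma pderiv_cont (g : R -> C) (t : R) (l : C) : pderiv g t l -> pcont g t.
Proof.
  intros H. apply (ex_derive_continuous (K := R_AbsRing) (V := C_R_NormedModule)).
  now exists l.
Qed.

Lemma pcont_comp (f : C -> C) (g : R -> C) (t : R) :
  ccont f (g t) -> pcont g t -> pcont (fun s => f (g s)) t.
Proof. intros Hf Hg. exact (continuous_comp g f t Hg Hf). Qed.

Lemma ccont_const (k z : C) : ccont (fun _ => k) z.
Proof. apply continuous_const. Qed.

Lemma ccont_id (z : C) : ccont (fun w => w) z.
Proof. apply continuous_id. Qed.

Lemma continuous_AbsRing {U : UniformSpace} (f : U -> C) (x : U) :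
  @continuous U C_UniformSpace f x <-> @continuous U (AbsRing_UniformSpace C_AbsRing) f x.
Proof. split; intros H P HP; apply H; now apply locally_C. Qed.

Lemma continuous_Cmult {U : UniformSpace} (f g : U -> C) (x : U) :
  @continuous U C_UniformSpace f x -> @continuous U C_UniformSpace g x ->
  @continuous U C_UniformSpace (fun y => f y * g y)%C x.
Proof. rewrite !continuous_AbsRing. exact (continuous_mult (K := C_AbsRing) f g x). Qed.

Lemma continuous_Cminus {U : UniformSpace} (f g : U -> C) (x : U) :
  @continuous U C_UniformSpace f x -> @continuous U C_UniformSpace g x ->
  @continuous U C_UniformSpace (fun y => f y - g y)%C x.
Proof. exact (continuous_minus (K := C_AbsRing) (V := C_NormedModule) f g x). Qed.

Lemma continuous_Cinv {U : UniformSpace} (f : U -> C) (x : U) :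
  @continuous U C_UniformSpace f x -> f x <> RtoC 0 ->
  @continuous U C_UniformSpace (fun y => / f y)%C x.
Proof.
  intros Hf H0. apply (continuous_comp f Cinv); [easy|].
  exact (cderiv_cont _ _ _ (cderiv_Cinv _ H0)).
Qed.

Lemma continuous_Cdiv {U : UniformSpace} (f g : U -> C) (x : U) :
  @continuous U C_UniformSpace f x -> @continuous U C_UniformSpace g x -> g x <> RtoC 0 ->
  @continuous U C_UniformSpace (fun y => f y / g y)%C x.
Proof. intros Hf Hg H0. apply continuous_Cmult; [easy|now apply continuous_Cinv]. Qed.

Lemma continuous_Cmod {U : UniformSpace} (f : U -> C) (x : U) :
  @continuous U C_UniformSpace f x -> continuous (fun y => Cmod (f y)) x.
Proof.
  intros Hf. apply (continuous_comp f Cmod); [easy|].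
  exact (filterlim_norm (K := C_AbsRing) (V := C_NormedModule) (f x)).
Qed.

(** * Integrals of complex-valued functions, along intervals and segments *)

Notation CInt := (@RInt C_R_CompleteNormedModule) (only parsing).
Notation is_CInt := (@is_RInt C_R_NormedModule) (only parsing).
Notation ex_CInt := (@ex_RInt C_R_NormedModule) (only parsing).

Lemma ex_CInt_cont (g : R -> C) (a b : R) : a <= b ->
  (forall t, a <= t <= b -> pcont g t) -> ex_CInt g a b.
Proof.
  intros ab H. apply (ex_RInt_continuous (V := C_R_CompleteNormedModule)).
  intros t. rewrite Rmin_left, Rmax_right by easy. apply H.
Qed.

(** The integral is only R-linear by construction; C-linearity is read off the
    coordinates. *)
Lemma is_CInt_Cmult (k : C) (g : R -> C) (a b : R) (l : C) :
  is_CInt g a b l -> is_CInt (fun t => k * g t)%C a b (k * l)%C.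
Proof.
  intros H.
  assert (H1 := is_RInt_fct_extend_fst (U := R_NormedModule) (V := R_NormedModule) _ _ _ _ H).
  assert (H2 := is_RInt_fct_extend_snd (U := R_NormedModule) (V := R_NormedModule) _ _ _ _ H).
  apply (is_RInt_fct_extend_pair (U := R_NormedModule) (V := R_NormedModule)); simpl.
  - apply (is_RInt_minus (V := R_NormedModule)); now apply (is_RInt_scal (V := R_NormedModule)).
  - apply (is_RInt_plus (V := R_NormedModule)); now apply (is_RInt_scal (V := R_NormedModule)).
Qed.

Lemma CInt_Cmult (k : C) (g : R -> C) (a b : R) : ex_CInt g a b ->
  CInt (fun t => k * g t)%C a b = (k * CInt g a b)%C.
Proof.
  intros H. apply (is_RInt_unique (V := C_R_CompleteNormedModule)), is_CInt_Cmult.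
  now apply (RInt_correct (V := C_R_CompleteNormedModule)).
Qed.

Lemma ex_CInt_Cmult (k : C) (g : R -> C) (a b : R) : ex_CInt g a b ->
  ex_CInt (fun t => k * g t)%C a b.
Proof. intros [l H]. exists (k * l)%C. now apply is_CInt_Cmult. Qed.

Lemma CInt_plus (f g : R -> C) (a b : R) : ex_CInt f a b -> ex_CInt g a b ->
  CInt (fun t => f t + g t)%C a b = (CInt f a b + CInt g a b)%C.
Proof. apply (RInt_plus (V := C_R_CompleteNormedModule)). Qed.

Lemma CInt_minus (f g : R -> C) (a b : R) : ex_CInt f a b -> ex_CInt g a b ->
  CInt (fun t => f t - g t)%C a b = (CInt f a b - CInt g a b)%C.
Proof. apply (RInt_minus (V := C_R_CompleteNormedModule)). Qed.

Lemma CInt_ext (f g : R -> C) (a b : R) : a <= b ->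
  (forall t, a <= t <= b -> f t = g t) -> CInt f a b = CInt g a b.
Proof.
  intros ab H. apply (RInt_ext (V := C_R_CompleteNormedModule)).
  rewrite Rmin_left, Rmax_right by easy. intros t Ht. apply H. lra.
Qed.

Lemma CInt_const (k : C) (a b : R) : CInt (fun _ => k) a b = (RtoC (b - a) * k)%C.
Proof. rewrite (RInt_const (V := C_R_CompleteNormedModule)). apply scal_R_Cmult. Qed.

Lemma Cmod_CInt_le (f : R -> C) (g : R -> R) (a b : R) : a <= b ->
  (forall t, a <= t <= b -> Cmod (f t) <= g t) -> ex_CInt f a b -> ex_RInt g a b ->
  Cmod (CInt f a b) <= RInt g a b.
Proof.
  intros ab H Hf Hg. rewrite <- Cmod_prod_norm.
  apply (norm_RInt_le (V := C_R_NormedModule) f g a b); try easy.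
  - intros t Ht. rewrite Cmod_prod_norm. now apply H.
  - now apply (RInt_correct (V := C_R_CompleteNormedModule)).
  - now apply (RInt_correct (V := R_CompleteNormedModule)).
Qed.

Lemma Cmod_CInt_le_const (f : R -> C) (M a b : R) : a <= b ->
  (forall t, a <= t <= b -> Cmod (f t) <= M) -> ex_CInt f a b ->
  Cmod (CInt f a b) <= (b - a) * M.
Proof.
  intros ab H Hf. eapply Rle_trans.
  - apply (Cmod_CInt_le f (fun _ => M)); try easy. apply ex_RInt_const.
  - rewrite RInt_const. apply Rle_refl.
Qed.

Lemma CInt_derive (F f : R -> C) (a b : R) : a <= b ->
  (forall t, a <= t <= b -> pderiv F t (f t)) ->
  (forall t, a <= t <= b -> pcont f t) ->
  CInt f a b = (F b - F a)%C.
Proof.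
  intros ab HF Hf. apply (is_RInt_unique (V := C_R_CompleteNormedModule)).
  apply (is_RInt_derive (V := C_R_CompleteNormedModule)); rewrite Rmin_left, Rmax_right; easy.
Qed.

Definition line (a b : C) (t : R) : C := (a + RtoC t * (b - a))%C.

Definition seg_int (f : C -> C) (a b : C) : C :=
  ((b - a) * CInt (fun t => f (line a b t)) 0 1)%C.

Definition segcont (f : C -> C) (a b : C) : Prop :=
  forall t, 0 <= t <= 1 -> ccont f (line a b t).

Lemma pderiv_line (a b : C) (t : R) : pderiv (line a b) t (b - a)%C.
Proof.
  apply pderiv_eps. intros eps He. exists 1. split; [lra|]. intros s _.
  unfold line.
  replace (a + s * (b - a) - (a + t * (b - a)) - (RtoC (s - t)) * (b - a))%C with (RtoC 0).
  - rewrite Cmod_0. apply Rmult_le_pos; [lra|apply Rabs_pos].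
  - rewrite RtoC_minus. ring.
Qed.

Lemma pcont_line (f : C -> C) (a b : C) (t : R) : ccont f (line a b t) ->
  pcont (fun t => f (line a b t)) t.
Proof.
  intros H. apply pcont_comp; [easy|]. apply (pderiv_cont _ _ _ (pderiv_line a b t)).
Qed.

Lemma ex_CInt_line (f : C -> C) (a b : C) (s t : R) : 0 <= s <= t -> t <= 1 ->
  segcont f a b -> ex_CInt (fun t => f (line a b t)) s t.
Proof.
  intros Hs Ht H. apply ex_CInt_cont; [lra|]. intros u Hu. apply pcont_line, H. lra.
Qed.

Lemma line_0 (a b : C) : line a b 0 = a.
Proof. unfold line. ring. Qed.

Lemma line_1 (a b : C) : line a b 1 = b.
Proof. unfold line. ring. Qed.

Lemma line_line (a b : C) (s u t : R) :
  line (line a b s) (line a b u) t = line a b (s + t * (u - s)).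
Proof. unfold line. rewrite RtoC_plus, RtoC_mult, RtoC_minus. ring. Qed.

(** All segments on one line are reduced to integrals of one function of the
    parameter.  The order of [s] and [u] is free, so that both splitting and reversal follow. *)
Lemma seg_int_sub (f : C -> C) (a b : C) (s u : R) :
  segcont f a b -> 0 <= s <= 1 -> 0 <= u <= 1 ->
  seg_int f (line a b s) (line a b u) = ((b - a) * CInt (fun t => f (line a b t)) s u)%C.
Proof.
  intros H Hs Hu. unfold seg_int.
  assert (E : ex_CInt (fun t => f (line a b t)) s u).
  { apply (ex_RInt_continuous (V := C_R_CompleteNormedModule)). intros t Ht.
    apply pcont_line, H. split.
    - apply Rle_trans with (2 := proj1 Ht). now apply Rmin_glb.
    - apply Rle_trans with (1 := proj2 Ht). now apply Rmax_lub. }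
  assert (X := RInt_comp_lin (V := C_R_CompleteNormedModule)
    (fun t => f (line a b t)) (u - s) s 0 1).
  replace ((u - s) * 0 + s) with s in X by ring.
  replace ((u - s) * 1 + s) with u in X by ring.
  rewrite <- (X E).
  rewrite (CInt_ext (fun y => scal (u - s) (f (line a b ((u - s) * y + s))))
    (fun y => RtoC (u - s) * f (line (line a b s) (line a b u) y))%C).
  - rewrite CInt_Cmult.
    + unfold line at 1 2. rewrite RtoC_minus. ring.
    + apply ex_CInt_line; try lra. intros t Ht. rewrite line_line. apply H.
      split; nra.
  - lra.
  - intros t Ht. rewrite scal_R_Cmult, line_line. do 3 f_equal. ring.
Qed.

Lemma seg_int_split (f : C -> C) (a b : C) (s : R) : segcont f a b -> 0 <= s <= 1 ->
  (seg_int f a (line a b s) + seg_int f (line a b s) b)%C = seg_int f a b.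
Proof.
  intros H Hs.
  assert (E1 := seg_int_sub f a b 0 s H ltac:(lra) Hs).
  assert (E2 := seg_int_sub f a b s 1 H Hs ltac:(lra)).
  rewrite line_0 in E1. rewrite line_1 in E2. rewrite E1, E2. unfold seg_int.
  rewrite <- Cmult_plus_distr_l. f_equal.
  apply (RInt_Chasles (V := C_R_CompleteNormedModule)); apply ex_CInt_line; easy || lra.
Qed.

Lemma seg_int_swap (f : C -> C) (a b : C) : segcont f a b -> seg_int f b a = (- seg_int f a b)%C.
Proof.
  intros H.
  assert (E := seg_int_sub f a b 1 0 H ltac:(lra) ltac:(lra)).
  rewrite line_0, line_1 in E. rewrite E. unfold seg_int.
  rewrite <- (opp_RInt_swap (V := C_R_CompleteNormedModule)).
  - change (opp ?x) with (Copp x). ring.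
  - apply ex_CInt_line; easy || lra.
Qed.

Lemma seg_int_point (f : C -> C) (a : C) : seg_int f a a = RtoC 0.
Proof. unfold seg_int. ring. Qed.

Lemma seg_int_bound (f : C -> C) (a b : C) (M : R) : segcont f a b ->
  (forall t, 0 <= t <= 1 -> Cmod (f (line a b t)) <= M) ->
  Cmod (seg_int f a b) <= M * Cmod (b - a).
Proof.
  intros H HM. unfold seg_int. rewrite Cmod_mult, Rmult_comm.
  apply Rmult_le_compat_r; [apply Cmod_ge_0|].
  replace M with ((1 - 0) * M) by ring.
  apply Cmod_CInt_le_const; [lra|easy|apply ex_CInt_line; easy || lra].
Qed.

Lemma seg_int_minus (f g : C -> C) (a b : C) : segcont f a b -> segcont g a b ->
  seg_int (fun z => f z - g z)%C a b = (seg_int f a b - seg_int g a b)%C.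
Proof.
  intros Hf Hg. unfold seg_int. rewrite CInt_minus by (apply ex_CInt_line; easy || lra). ring.
Qed.

Lemma seg_int_primitive (F f : C -> C) (a b : C) : segcont f a b ->
  (forall t, 0 <= t <= 1 -> cderiv F (line a b t) (f (line a b t))) ->
  seg_int f a b = (F b - F a)%C.
Proof.
  intros Hf HF. unfold seg_int.
  rewrite <- CInt_Cmult by (apply ex_CInt_line; easy || lra).
  replace (F b - F a)%C with (F (line a b 1) - F (line a b 0))%C
    by now rewrite line_0, line_1.
  apply CInt_derive with (F := fun t => F (line a b t)); [lra| |].
  - intros t Ht. rewrite Cmult_comm. apply pderiv_comp; [now apply HF|apply pderiv_line].
  - intros t Ht. apply (pcont_comp (fun z => (b - a) * z)%C).
    + eapply cderiv_cont, (cderiv_scal _ (fun z => z)), cderiv_id.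
    + now apply pcont_line, Hf.
Qed.

(** * Goursat's theorem on triangles *)

Definition convex (K : C -> Prop) : Prop :=
  forall a b t, K a -> K b -> 0 <= t <= 1 -> K (line a b t).

(** Closedness with the modulus in place of filters, the form in which limits of
    nested triangles are used. *)
Definition adherent_closed (K : C -> Prop) : Prop :=
  forall z, (forall eps, 0 < eps -> exists p, K p /\ Cmod (p - z) < eps) -> K z.

Definition tri_int (f : C -> C) (a b c : C) : C := (seg_int f a b + seg_int f b c + seg_int f c a)%C.

(** The perimeter.  It halves exactly under subdivision and bounds all distances
    inside the triangle. *)
Definition side (a b c : C) : R := Cmod (b - a) + Cmod (c - b) + Cmod (a - c).

Lemma Cmod_swap (a b : C) : Cmod (a - b) = Cmod (b - a).
Proof. rewrite <- Cmod_opp. f_equal. ring. Qed.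

Definition mid (a b : C) : C := line a b (1 / 2).

Lemma mid_eq (a b : C) : mid a b = ((a + b) / 2)%C.
Proof. unfold mid, line. rewrite RtoC_div by lra. field. Qed.

Lemma Cmod_half (z : C) : Cmod (z / 2)%C = Cmod z / 2.
Proof.
  replace (z / 2)%C with (RtoC (/ 2) * z)%C by (rewrite RtoC_inv by lra; field).
  rewrite Cmod_mult, Cmod_R, Rabs_pos_eq by lra. lra.
Qed.

(** Cut the triangle at the midpoints of its sides: the inner sides cancel, so one of
    the four pieces carries at least a quarter of the integral. *)
Lemma tri_int_quarter (K : C -> Prop) (f : C -> C) (a b c : C) :
  convex K -> (forall z, K z -> ccont f z) -> K a -> K b -> K c ->
  exists a' b' c', (K a' /\ K b' /\ K c') /\ side a' b' c' = side a b c / 2 /\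
    Cmod (a' - a) <= side a b c /\ Cmod (tri_int f a b c) <= 4 * Cmod (tri_int f a' b' c').
Proof.
  intros HK Hf Ka Kb Kc.
  assert (SC : forall p q, K p -> K q -> segcont f p q).
  { intros p q Hp Hq t Ht. now apply Hf, HK. }
  assert (M : forall p q, K p -> K q -> K (mid p q)).
  { intros p q Hp Hq. apply HK; try easy. lra. }
  assert (Kab := M a b Ka Kb). assert (Kbc := M b c Kb Kc). assert (Kca := M c a Kc Ka).
  assert (E : tri_int f a b c = (tri_int f a (mid a b) (mid c a) + tri_int f (mid a b) b (mid b c)
    + tri_int f (mid c a) (mid b c) c + tri_int f (mid a b) (mid b c) (mid c a))%C).
  { unfold tri_int.
    rewrite <- (seg_int_split f a b (1/2)), <- (seg_int_split f b c (1/2)), <- (seg_int_split f c a (1/2));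
      try lra; try (now apply SC).
    fold (mid a b) (mid b c) (mid c a).
    rewrite (seg_int_swap f (mid c a) (mid a b)), (seg_int_swap f (mid a b) (mid b c)),
      (seg_int_swap f (mid b c) (mid c a)) by now apply SC.
    ring. }
  assert (Hs : forall p q r p' q' r', p = (p' / 2)%C -> q = (q' / 2)%C -> r = (r' / 2)%C ->
    Cmod p + Cmod q + Cmod r = (Cmod p' + Cmod q' + Cmod r') / 2).
  { intros p q r p' q' r' -> -> ->. rewrite !Cmod_half. lra. }
  set (x1 := tri_int f a (mid a b) (mid c a)) in *.
  set (x2 := tri_int f (mid a b) b (mid b c)) in *.
  set (x3 := tri_int f (mid c a) (mid b c) c) in *.
  set (x4 := tri_int f (mid a b) (mid b c) (mid c a)) in *.
  assert (Hle : Cmod (tri_int f a b c) <= Cmod x1 + Cmod x2 + Cmod x3 + Cmod x4).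
  { rewrite E. eapply Rle_trans; [apply Cmod_triangle|]. apply Rplus_le_compat_r.
    eapply Rle_trans; [apply Cmod_triangle|]. apply Rplus_le_compat_r. apply Cmod_triangle. }
  assert (P1 := Cmod_ge_0 (b - a)). assert (P2 := Cmod_ge_0 (c - b)).
  assert (P3 := Cmod_ge_0 (a - c)).
  assert (Dab : Cmod (mid a b - a) <= side a b c).
  { replace (mid a b - a)%C with ((b - a) / 2)%C by (rewrite mid_eq; field).
    rewrite Cmod_half. unfold side. lra. }
  assert (Dca : Cmod (mid c a - a) <= side a b c).
  { replace (mid c a - a)%C with (- ((a - c) / 2))%C by (rewrite mid_eq; field).
    rewrite Cmod_opp, Cmod_half. unfold side. lra. }
  destruct (Rle_dec (Cmod (tri_int f a b c)) (4 * Cmod x1)) as [H1|H1].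
  { exists a, (mid a b), (mid c a). split; [easy|]. split; [|split; [|exact H1]].
    - unfold side. rewrite !mid_eq. apply Hs; field.
    - replace (a - a)%C with (RtoC 0) by ring. rewrite Cmod_0. unfold side. lra. }
  destruct (Rle_dec (Cmod (tri_int f a b c)) (4 * Cmod x2)) as [H2|H2].
  { exists (mid a b), b, (mid b c). split; [easy|]. split; [|split; [easy|exact H2]].
    unfold side. rewrite !mid_eq. apply Hs; field. }
  destruct (Rle_dec (Cmod (tri_int f a b c)) (4 * Cmod x3)) as [H3|H3].
  { exists (mid c a), (mid b c), c. split; [easy|]. split; [|split; [easy|exact H3]].
    unfold side. rewrite !mid_eq. apply Hs; field. }
  exists (mid a b), (mid b c), (mid c a). split; [easy|]. split; [|split; [easy|fold x4; lra]].
  unfold side. rewrite !mid_eq, (Hs _ _ _ (c - a) (a - b) (b - c))%C by field.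
  rewrite (Cmod_swap c a), (Cmod_swap a b), (Cmod_swap b c). lra.
Qed.

Lemma R_cauchy_geom (u : nat -> R) (d : R) : 0 <= d ->
  (forall n, Rabs (u (S n) - u n) <= d / 2 ^ n) ->
  exists l, forall n, Rabs (u n - l) <= 2 * d / 2 ^ n.
Proof.
  intros d0 H.
  assert (P : forall n, 0 < 2 ^ n) by (intros; apply pow_lt; lra).
  assert (D : forall n k, Rabs (u (n + k)%nat - u n) <= 2 * d / 2 ^ n - 2 * d / 2 ^ (n + k)).
  { intros n k. induction k as [|k IH].
    - rewrite Nat.add_0_r, Rminus_diag, Rminus_diag, Rabs_R0. lra.
    - replace (u (n + S k)%nat - u n) with ((u (S (n + k)) - u (n + k)%nat) + (u (n + k)%nat - u n))
        by (rewrite Nat.add_succ_r; ring).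
      eapply Rle_trans; [apply Rabs_triang|].
      assert (Hn := H (n + k)%nat).
      replace (2 * d / 2 ^ (n + S k)) with (d / 2 ^ (n + k)).
      + replace (2 * d / 2 ^ (n + k)) with (2 * (d / 2 ^ (n + k))) in IH by (unfold Rdiv; ring).
        lra.
      + rewrite Nat.add_succ_r. simpl. field. apply Rgt_not_eq, P. }
  assert (D' : forall n k, Rabs (u (n + k)%nat - u n) <= 2 * d / 2 ^ n).
  { intros n k. specialize (D n k).
    assert (0 <= 2 * d / 2 ^ (n + k)); [|lra]. 
    apply Rmult_le_pos; [lra|]. now apply Rlt_le, Rinv_0_lt_compat. }
  destruct (Rcomplete.R_complete u) as [l Hl].
  { intros eps He.
    destruct (pow_lt_1_zero (/ 2)) with (y := eps / (4 * d + 1)) as [N HN].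
    { rewrite Rabs_pos_eq; lra. }
    { apply Rdiv_lt_0_compat; lra. }
    assert (Small : 2 * d / 2 ^ N < eps / 2).
    { specialize (HN N (le_n N)). rewrite Rabs_pos_eq in HN by (apply pow_le; lra).
      rewrite pow_inv in HN. apply Rlt_div_r in HN; [|lra].
      unfold Rdiv in *. assert (Q := Rinv_0_lt_compat _ (P N)). nra. }
    exists N. intros n m Hn Hm. unfold Rdist.
    assert (A1 := D' N (n - N)%nat). assert (A2 := D' N (m - N)%nat).
    replace (N + (n - N))%nat with n in A1 by lia.
    replace (N + (m - N))%nat with m in A2 by lia.
    apply Rabs_le_between in A1. apply Rabs_le_between in A2.
    apply Rabs_lt_between. lra. }
  exists l. intros n. apply le_epsilon. intros eps He.
  destruct (Hl eps He) as [N HN].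
  specialize (HN (n + N)%nat ltac:(lia)). unfold Rdist in HN.
  specialize (D' n N).
  apply Rabs_lt_between in HN. apply Rabs_le_between in D'.
  apply Rabs_le_between. lra.
Qed.

Lemma fst_le_Cmod (z : C) : Rabs (fst z) <= Cmod z.
Proof. apply re_le_Cmod. Qed.

Lemma snd_le_Cmod (z : C) : Rabs (snd z) <= Cmod z.
Proof.
  eapply Rle_trans; [apply Rmax_r|apply Rmax_Cmod].
Qed.

Lemma Cmod_le_abs (z : C) : Cmod z <= Rabs (fst z) + Rabs (snd z).
Proof.
  replace z with (RtoC (fst z) + Ci * RtoC (snd z))%C at 1.
  - eapply Rle_trans; [apply Cmod_triangle|].
    rewrite Cmod_mult, !Cmod_R.
    replace (Cmod Ci) with 1. lra.
    unfold Cmod, Ci. simpl. replace (0 * (0 * 1) + 1 * (1 * 1)) with 1 by ring.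
    now rewrite sqrt_1.
  - destruct z as [x y]. unfold Cplus, Cmult, RtoC, Ci. simpl. f_equal; ring.
Qed.

Lemma C_cauchy_geom (u : nat -> C) (d : R) : 0 <= d ->
  (forall n, Cmod (u (S n) - u n) <= d / 2 ^ n) ->
  exists l, forall n, Cmod (u n - l) <= 4 * d / 2 ^ n.
Proof.
  intros d0 H.
  destruct (R_cauchy_geom (fun n => fst (u n)) d d0) as [x Hx].
  { intros n. eapply Rle_trans; [|apply H]. apply (fst_le_Cmod (u (S n) - u n)). }
  destruct (R_cauchy_geom (fun n => snd (u n)) d d0) as [y Hy].
  { intros n. eapply Rle_trans; [|apply H]. apply (snd_le_Cmod (u (S n) - u n)). }
  exists (x, y). intros n. eapply Rle_trans; [apply Cmod_le_abs|].
  specialize (Hx n). specialize (Hy n). simpl.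
  replace (4 * d / 2 ^ n) with (2 * d / 2 ^ n + 2 * d / 2 ^ n) by (unfold Rdiv; ring).
  unfold Rminus in *. lra.
Qed.

Lemma line_dist (a b z : C) (t : R) : 0 <= t <= 1 ->
  Cmod (line a b t - z) <= Cmod (a - z) + Cmod (b - a).
Proof.
  intros Ht. unfold line.
  replace (a + t * (b - a) - z)%C with ((a - z) + t * (b - a))%C by ring.
  eapply Rle_trans; [apply Cmod_triangle|]. apply Rplus_le_compat_l.
  rewrite Cmod_mult, Cmod_R, Rabs_pos_eq by lra.
  rewrite <- (Rmult_1_l (Cmod (b - a))) at 2.
  apply Rmult_le_compat_r; [apply Cmod_ge_0|lra].
Qed.

Lemma tri_int_bound (f : C -> C) (a b c : C) (M : R) :
  segcont f a b -> segcont f b c -> segcont f c a ->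
  (forall t, 0 <= t <= 1 -> Cmod (f (line a b t)) <= M /\ Cmod (f (line b c t)) <= M
     /\ Cmod (f (line c a t)) <= M) ->
  Cmod (tri_int f a b c) <= M * side a b c.
Proof.
  intros H1 H2 H3 HM. unfold tri_int, side.
  eapply Rle_trans; [apply Cmod_triangle|].
  assert (A1 := seg_int_bound f a b M H1 (fun t Ht => proj1 (HM t Ht))).
  assert (A2 := seg_int_bound f b c M H2 (fun t Ht => proj1 (proj2 (HM t Ht)))).
  assert (A3 := seg_int_bound f c a M H3 (fun t Ht => proj2 (proj2 (HM t Ht)))).
  assert (A4 := Cmod_triangle (seg_int f a b) (seg_int f b c)). lra.
Qed.

Lemma tri_int_primitive (F f : C -> C) (a b c : C) :
  (forall z, ccont f z) -> (forall z, cderiv F z (f z)) -> tri_int f a b c = RtoC 0.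
Proof.
  intros Hf HF. unfold tri_int.
  rewrite !(seg_int_primitive F f); try (intros t _; easy). ring.
Qed.

(** An affine function has a primitive, so only the remainder of the first order
    expansion at [z] contributes, and it is small compared with the distance to [z]. *)
Lemma tri_int_small (K : C -> Prop) (f : C -> C) (z : C) (eps : R) :
  convex K -> (forall w, K w -> ccont f w) -> @ex_derive C_AbsRing C_NormedModule f z ->
  0 < eps -> exists d, 0 < d /\ forall a b c, K a -> K b -> K c ->
    Cmod (a - z) + side a b c < d ->
    Cmod (tri_int f a b c) <= eps * (Cmod (a - z) + side a b c) * side a b c.
Proof.
  intros HK Hf [l Hl] He. rewrite cderiv_eps in Hl. destruct (Hl eps He) as [d [d0 Hd]].
  exists d. split; [easy|]. intros a b c Ka Kb Kc Hs.
  set (A := fun w : C => (f z + l * (w - z))%C).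
  assert (HA : forall w, cderiv A w l).
  { intros w. apply (cderiv_eq _ _ (RtoC 0 + l * RtoC 1)%C); [|ring].
    apply cderiv_plus; [apply cderiv_const|].
    apply (cderiv_scal l (fun w => w - z)%C), cderiv_shift. }
  assert (CA : forall w, ccont A w) by (intros w; eapply cderiv_cont, HA).
  set (P := fun w : C => (f z * w + (l / 2) * ((w - z) * (w - z)))%C).
  assert (HP : forall w, cderiv P w (A w)).
  { intros w.
    apply (cderiv_eq _ _ (f z * 1 + l / 2 * (1 * (w - z) + (w - z) * 1))%C);
      [|unfold A; field].
    apply cderiv_plus.
    - apply (cderiv_scal (f z) (fun w => w)), cderiv_id.
    - apply (cderiv_scal (l / 2)%C (fun w => (w - z) * (w - z))%C).
      apply (cderiv_mult (fun w => w - z)%C (fun w => w - z)%C); apply cderiv_shift. }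
  assert (SC : forall p q, K p -> K q -> segcont f p q).
  { intros p q Hp Hq t Ht. now apply Hf, HK. }
  assert (SA : forall p q, segcont A p q) by (intros p q t _; apply CA).
  replace (tri_int f a b c) with (tri_int (fun w => f w - A w)%C a b c).
  - apply tri_int_bound.
    + intros t Ht. apply continuous_Cminus; [now apply SC|apply CA].
    + intros t Ht. apply continuous_Cminus; [now apply SC|apply CA].
    + intros t Ht. apply continuous_Cminus; [now apply SC|apply CA].
    + assert (X : forall p q t, 0 <= t <= 1 -> Cmod (p - z) + Cmod (q - p) <= Cmod (a - z) + side a b c ->
        Cmod (f (line p q t) - A (line p q t)) <= eps * (Cmod (a - z) + side a b c)).
      { intros p q t Ht Hpq. assert (L := line_dist p q z t Ht).
        unfold A. set (w := line p q t) in *.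
        replace (f w - (f z + l * (w - z)))%C with (f w - f z - l * (w - z))%C by ring.
        eapply Rle_trans; [apply Hd; lra|]. apply Rmult_le_compat_l; lra. }
      assert (P1 := Cmod_ge_0 (b - a)). assert (P2 := Cmod_ge_0 (c - b)).
      assert (P3 := Cmod_ge_0 (a - c)).
      intros t Ht. repeat split; apply X; try easy; unfold side.
      * lra.
      * assert (T := Cmod_triangle (b - a) (a - z)).
        replace (b - a + (a - z))%C with (b - z)%C in T by ring. lra.
      * assert (T := Cmod_triangle (c - a) (a - z)).
        replace (c - a + (a - z))%C with (c - z)%C in T by ring.
        rewrite (Cmod_swap c a) in T.
        assert (T2 := Cmod_triangle (b - a) (c - b)).
        replace (b - a + (c - b))%C with (c - a)%C in T2 by ring.
        rewrite (Cmod_swap c a) in T2. lra.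
  - transitivity (tri_int f a b c - tri_int A a b c)%C.
    + unfold tri_int. rewrite !seg_int_minus by (auto). ring.
    + rewrite (tri_int_primitive P A) by easy. ring.
Qed.

(** Nested quarters shrink to a point [z] of [K].  The n-th integral is at least 4^-n
    times the first, while differentiability at [z] makes it o(4^-n). *)
Theorem goursat (K : C -> Prop) (f : C -> C) (a b c : C) :
  convex K -> adherent_closed K ->
  (forall z, K z -> @ex_derive C_AbsRing C_NormedModule f z) ->
  K a -> K b -> K c -> tri_int f a b c = RtoC 0.
Proof.
  intros HK HC Hf Ka Kb Kc.
  assert (Cf : forall z, K z -> ccont f z).
  { intros z Hz. destruct (Hf z Hz) as [l Hl]. now apply cderiv_cont in Hl. }
  (* triangles as triples, followed through their first vertex *)
  set (good := fun p : C * C * C => let '(a, b, c) := p in K a /\ K b /\ K c).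
  set (sd := fun p : C * C * C => let '(a, b, c) := p in side a b c).
  set (tr := fun p : C * C * C => let '(a, b, c) := p in Cmod (tri_int f a b c)).
  set (vx := fun p : C * C * C => fst (fst p)).
  assert (Step : forall p, exists q, good p -> good q /\ sd q = sd p / 2 /\
    Cmod (vx q - vx p) <= sd p /\ tr p <= 4 * tr q).
  { intros [[a1 b1] c1].
    destruct (classic (good (a1, b1, c1))) as [[G1 [G2 G3]]|N].
    - destruct (tri_int_quarter K f a1 b1 c1 HK Cf G1 G2 G3) as [a' [b' [c' Q]]].
      exists (a', b', c'). intros _. exact Q.
    - exists (a1, b1, c1). intros G. now destruct N. }
  set (step := fun p => proj1_sig (constructive_indefinite_description _ (Step p))).
  assert (HS : forall p, good p -> good (step p) /\ sd (step p) = sd p / 2 /\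
    Cmod (vx (step p) - vx p) <= sd p /\ tr p <= 4 * tr (step p)).
  { intros p. exact (proj2_sig (constructive_indefinite_description _ (Step p))). }
  set (T := fun n => Nat.iter n step (a, b, c)).
  set (s := side a b c).
  assert (s0 : 0 <= s).
  { unfold s, side. assert (P1 := Cmod_ge_0 (b - a)). assert (P2 := Cmod_ge_0 (c - b)).
    assert (P3 := Cmod_ge_0 (a - c)). lra. }
  assert (P : forall n, 0 < 2 ^ n) by (intros; apply pow_lt; lra).
  assert (HT : forall n, good (T n) /\ sd (T n) = s / 2 ^ n /\ tr (a, b, c) <= 4 ^ n * tr (T n)).
  { intros n. induction n as [|n [G [S1 R1]]].
    - repeat split; try easy; simpl; unfold s; try lra.
    - destruct (HS (T n) G) as [G' [S2 [_ R2]]].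
      change (T (S n)) with (step (T n)). split; [easy|]. split.
      + rewrite S2, S1. simpl. field. apply Rgt_not_eq, P.
      + eapply Rle_trans; [exact R1|]. rewrite <- tech_pow_Rmult, (Rmult_comm 4), Rmult_assoc.
        apply Rmult_le_compat_l; [apply pow_le; lra|exact R2]. }
  destruct (C_cauchy_geom (fun n => vx (T n)) s s0) as [z Hz].
  { intros n. destruct (HT n) as [G [S1 _]]. rewrite <- S1.
    apply (HS (T n) G). }
  assert (Kz : K z).
  { apply HC. intros eps He.
    destruct (pow_lt_1_zero (/ 2)) with (y := eps / (4 * s + 1)) as [N HN].
    { rewrite Rabs_pos_eq; lra. }
    { apply Rdiv_lt_0_compat; lra. }
    exists (vx (T N)). split.
    - destruct (HT N) as [G _]. destruct (T N) as [[x y] w]. apply G.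
    - eapply Rle_lt_trans; [apply Hz|].
      specialize (HN N (le_n N)). rewrite Rabs_pos_eq in HN by (apply pow_le; lra).
      rewrite pow_inv in HN. apply Rlt_div_r in HN; [|lra].
      unfold Rdiv in *. assert (Q := Rinv_0_lt_compat _ (P N)). nra. }
  apply Cmod_eq_0. apply Rle_antisym; [|apply Cmod_ge_0].
  apply le_epsilon. intros eps He. rewrite Rplus_0_l.
  destruct (tri_int_small K f z (eps / (5 * s * s + 1)) HK Cf (Hf z Kz)) as [d [d0 Hd]].
  { apply Rdiv_lt_0_compat; nra. }
  destruct (pow_lt_1_zero (/ 2)) with (y := d / (5 * s + 1)) as [N HN].
  { rewrite Rabs_pos_eq; lra. }
  { apply Rdiv_lt_0_compat; lra. }
  specialize (HN N (le_n N)). rewrite Rabs_pos_eq in HN by (apply pow_le; lra).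
  rewrite pow_inv in HN. apply Rlt_div_r in HN; [|lra].
  specialize (Hz N). cbv beta in Hz. destruct (HT N) as [G [S1 R1]].
  destruct (T N) as [[a1 b1] c1]. destruct G as [G1 [G2 G3]].
  unfold vx, sd, tr in *. simpl fst in Hz.
  assert (Q := Rinv_0_lt_compat _ (P N)).
  assert (L : Cmod (a1 - z) + side a1 b1 c1 <= 5 * s * / 2 ^ N).
  { rewrite S1. unfold Rdiv in *. lra. }
  assert (L' : Cmod (a1 - z) + side a1 b1 c1 < d) by nra.
  specialize (Hd a1 b1 c1 G1 G2 G3 L').
  eapply Rle_trans; [exact R1|].
  apply Rle_trans with (4 ^ N * (eps / (5 * s * s + 1) * (5 * s * / 2 ^ N) * (s * / 2 ^ N))).
  - apply Rmult_le_compat_l; [apply pow_le; lra|].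
    eapply Rle_trans; [exact Hd|]. rewrite S1 at 2.
    apply Rmult_le_compat_r; [apply Rmult_le_pos; lra|].
    apply Rmult_le_compat_l; [|exact L].
    apply Rlt_le, Rdiv_lt_0_compat; nra.
  - replace 4 with (2 * 2) by ring. rewrite Rpow_mult_distr.
    replace (2 ^ N * 2 ^ N * (eps / (5 * s * s + 1) * (5 * s * / 2 ^ N) * (s * / 2 ^ N)))
      with (eps * ((5 * s * s) / (5 * s * s + 1))) by (field; split; [apply Rgt_not_eq, P|nra]).
    rewrite <- (Rmult_1_r eps) at 2. apply Rmult_le_compat_l; [lra|].
    apply Rle_div_l; nra.
Qed.

(** * Primitives on discs, with one exceptional point *)

Notation cex := (@ex_derive C_AbsRing C_NormedModule) (only parsing).

Lemma cex_cont (f : C -> C) (z : C) : cex f z -> ccont f z.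
Proof. intros [l H]. exact (cderiv_cont f z l H). Qed.

Lemma line_conv (a b c : C) (t : R) :
  (line a b t - c)%C = (RtoC (1 - t) * (a - c) + RtoC t * (b - c))%C.
Proof. unfold line. rewrite RtoC_minus. ring. Qed.

Lemma Cmod_line_le (a b c : C) (t : R) : 0 <= t <= 1 ->
  Cmod (line a b t - c) <= (1 - t) * Cmod (a - c) + t * Cmod (b - c).
Proof.
  intros Ht. rewrite line_conv. eapply Rle_trans; [apply Cmod_triangle|].
  rewrite !Cmod_mult, !Cmod_R, !Rabs_pos_eq; lra.
Qed.

Lemma convex_disc (c : C) (R : R) : convex (fun z => Cmod (z - c) < R).
Proof.
  intros a b t Ha Hb Ht. eapply Rle_lt_trans; [now apply Cmod_line_le|].
  destruct (Req_dec t 0) as [->|T]; nra.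
Qed.

Lemma convex_cdisc (c : C) (R : R) : convex (fun z => Cmod (z - c) <= R).
Proof.
  intros a b t Ha Hb Ht. eapply Rle_trans; [now apply Cmod_line_le|]. nra.
Qed.

Lemma closed_cdisc (c : C) (R : R) : adherent_closed (fun z => Cmod (z - c) <= R).
Proof.
  intros z H. apply le_epsilon. intros eps He. destruct (H eps He) as [p [Hp Hz]].
  assert (T := Cmod_triangle (p - c) (z - p)).
  replace (p - c + (z - p))%C with (z - c)%C in T by ring.
  rewrite (Cmod_swap z p) in T. lra.
Qed.

(** The half plane orthogonal to [n] at distance [h / |n|] from [c]; for [h > 0] it
    is a closed convex set avoiding [c]. *)
Definition half_plane (c n : C) (h : R) (z : C) : Prop := h <= Re ((z - c) * Cconj n).

Lemma convex_half_plane (c n : C) (h : R) : convex (half_plane c n h).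
Proof.
  intros a b t Ha Hb Ht. unfold half_plane in *. rewrite line_conv.
  rewrite Cmult_plus_distr_r, <- !Cmult_assoc, re_plus, !re_scal_l. nra.
Qed.

Lemma closed_half_plane (c n : C) (h : R) : adherent_closed (half_plane c n h).
Proof.
  intros z H. apply le_epsilon. intros eps He.
  assert (N := Cmod_ge_0 n).
  destruct (H (eps / (Cmod n + 1))) as [p [Hp Hz]].
  { apply Rdiv_lt_0_compat; lra. }
  apply Rlt_div_r in Hz; [|lra].
  unfold half_plane in Hp.
  replace ((p - c) * Cconj n)%C with ((z - c) * Cconj n + (p - z) * Cconj n)%C in Hp by ring.
  rewrite re_plus in Hp.
  assert (T := re_le_Cmod ((p - z) * Cconj n)%C). rewrite Cmod_mult, Cmod_conj in T.
  apply Rabs_le_between in T. assert (Q := Cmod_ge_0 (p - z)). nra.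
Qed.

Lemma convex_inter (K L : C -> Prop) : convex K -> convex L -> convex (fun z => K z /\ L z).
Proof. intros HK HL a b t [Ka La] [Kb Lb] Ht. split; [now apply HK|now apply HL]. Qed.

Lemma closed_inter (K L : C -> Prop) : adherent_closed K -> adherent_closed L ->
  adherent_closed (fun z => K z /\ L z).
Proof.
  intros HK HL z H. split.
  - apply HK. intros e He. destruct (H e He) as [p [[Kp _] Hp]]. now exists p.
  - apply HL. intros e He. destruct (H e He) as [p [[_ Lp] Hp]]. now exists p.
Qed.

Lemma re_self_conj (n : C) : Re (n * Cconj n) = Cmod n ^ 2.
Proof. rewrite <- Cmod2_conj. reflexivity. Qed.

(** Triangles with a vertex at the exceptional point [z0].  Cut off a similar triangle
    at [z0] of ratio [t]: the rest lies in a half plane that avoids [z0], where Goursat's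
    theorem applies, and the part cut off has perimeter O(t) while [g] is bounded near [z0].
    The closeness of [z'] to [z] puts both in that half plane, even if the triangle is
    degenerate. *)
Lemma tri_int_punctured (g : C -> C) (c z0 z z' : C) (R : R) :
  (forall w, Cmod (w - c) < R -> ccont g w) ->
  (forall w, Cmod (w - c) < R -> w <> z0 -> cex g w) ->
  Cmod (z0 - c) < R -> Cmod (z - c) < R -> Cmod (z' - c) < R ->
  z <> z0 -> Cmod (z' - z) <= Cmod (z - z0) / 2 -> tri_int g z0 z z' = RtoC 0.
Proof.
  intros Hc Hd D0 D1 D2 Hz Hz'.
  set (n := (z - z0)%C) in *.
  assert (n0 : 0 < Cmod n). { apply Cmod_gt_0. intros E. apply Hz, Ceq_minus, E. }
  set (R1 := Rmax (Cmod (z0 - c)) (Rmax (Cmod (z - c)) (Cmod (z' - c)))).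
  assert (HR1 : R1 < R) by (repeat apply Rmax_lub_lt; easy).
  assert (I0 : Cmod (z0 - c) <= R1) by apply Rmax_l.
  assert (I1 : Cmod (z - c) <= R1) by (eapply Rle_trans; [apply Rmax_l|apply Rmax_r]).
  assert (I2 : Cmod (z' - c) <= R1) by (eapply Rle_trans; [apply Rmax_r|apply Rmax_r]).
  assert (SC : forall p q, Cmod (p - c) < R -> Cmod (q - c) < R -> segcont g p q).
  { intros p q Hp Hq t Ht. apply Hc. now apply (convex_disc c R). }
  assert (Rz : Re ((z - z0) * Cconj n) = Cmod n ^ 2) by apply re_self_conj.
  assert (Rz' : Cmod n ^ 2 / 2 <= Re ((z' - z0) * Cconj n)).
  { replace ((z' - z0) * Cconj n)%C with ((z - z0) * Cconj n + (z' - z) * Cconj n)%C by ring.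
    rewrite re_plus, Rz.
    assert (T := re_le_Cmod ((z' - z) * Cconj n)%C). rewrite Cmod_mult, Cmod_conj in T.
    apply Rabs_le_between in T. nra. }
  (* only the small triangle at [z0] contributes *)
  assert (Cut : forall t, 0 < t <= 1 ->
    tri_int g z0 z z' = tri_int g z0 (line z0 z t) (line z0 z' t)).
  { intros t Ht. set (p := line z0 z t). set (p' := line z0 z' t).
    set (K := fun w => Cmod (w - c) <= R1 /\ half_plane z0 n (t * (Cmod n ^ 2 / 2)) w).
    assert (HK : convex K) by (apply convex_inter; [apply convex_cdisc|apply convex_half_plane]).
    assert (CK : adherent_closed K)
      by (apply closed_inter; [apply closed_cdisc|apply closed_half_plane]).
    assert (n2 : 0 < Cmod n ^ 2 / 2) by nra.
    assert (tn : t * (Cmod n ^ 2 / 2) <= Cmod n ^ 2 / 2) by nra.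
    assert (dK : forall w, K w -> cex g w).
    { intros w [W1 W2]. apply Hd; [lra|]. intros ->. unfold half_plane in W2.
      replace ((z0 - z0) * Cconj n)%C with (RtoC 0) in W2 by ring. simpl in W2. nra. }
    assert (Kz : K z) by (split; [easy|unfold half_plane; rewrite Rz; lra]).
    assert (Kz' : K z') by (split; [easy|unfold half_plane; lra]).
    assert (Kp : forall y, Cmod (y - c) <= R1 -> Cmod n ^ 2 / 2 <= Re ((y - z0) * Cconj n) ->
      K (line z0 y t)).
    { intros y Y1 Y2. split.
      - apply (convex_cdisc c R1); try easy. lra.
      - unfold half_plane. rewrite line_conv, Cmult_plus_distr_r, <- !Cmult_assoc, re_plus, !re_scal_l.
        replace ((z0 - z0) * Cconj n)%C with (RtoC 0) by ring. change (Re (RtoC 0)) with 0.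
        assert (t * (Cmod n ^ 2 / 2) <= t * Re ((y - z0) * Cconj n))
          by (apply Rmult_le_compat_l; lra). lra. }
    assert (Kp1 : K p) by (apply Kp; [easy|rewrite Rz; lra]).
    assert (Kp2 : K p') by (apply Kp; easy).
    assert (G1 : tri_int g p z z' = RtoC 0) by now apply (goursat K).
    assert (G2 : tri_int g p z' p' = RtoC 0) by now apply (goursat K).
    unfold tri_int in *.
    assert (Dp : Cmod (p - c) < R) by (destruct Kp1; lra).
    assert (Dp' : Cmod (p' - c) < R) by (destruct Kp2; lra).
    assert (S1 := seg_int_split g z0 z t (SC _ _ D0 D1) ltac:(lra)). fold p in S1.
    assert (S2 := seg_int_split g z0 z' t (SC _ _ D0 D2) ltac:(lra)). fold p' in S2.
    rewrite (seg_int_swap g p z') in G1 by now apply SC.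
    rewrite (seg_int_swap g p p') in G2 by now apply SC.
    rewrite (seg_int_swap g z0 z'), (seg_int_swap g z0 p'), <- S1, <- S2 by now apply SC.
    assert (S3 := seg_int_swap g p' z' ltac:(now apply SC)). rewrite S3 in G2.
    transitivity (seg_int g z0 p + seg_int g p p' + - seg_int g z0 p'
      + (seg_int g p z + seg_int g z z' + - seg_int g p z') + (seg_int g p z' + - seg_int g p' z' + - seg_int g p p'))%C.
    - ring.
    - rewrite G1, G2. ring. }
  apply Cmod_eq_0, Rle_antisym; [|apply Cmod_ge_0].
  apply le_epsilon. intros eps He. rewrite Rplus_0_l.
  assert (Hz0 := Hc z0 D0). rewrite ccont_eps in Hz0.
  destruct (Hz0 1 Rlt_0_1) as [d [d0 Hd0]].
  assert (M0 := Cmod_ge_0 (g z0)).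
  set (M := Cmod (g z0) + 1).
  set (s := side z0 z z').
  assert (s0 : 0 <= s).
  { unfold s, side. assert (P1 := Cmod_ge_0 (z - z0)). assert (P2 := Cmod_ge_0 (z' - z)).
    assert (P3 := Cmod_ge_0 (z0 - z')). lra. }
  set (t := Rmin 1 (Rmin (d / (s + 1)) (eps / (M * s + 1)))).
  assert (t0 : 0 < t).
  { repeat apply Rmin_pos; try lra; apply Rdiv_lt_0_compat; unfold M; nra. }
  assert (t1 : t <= 1) by apply Rmin_l.
  assert (t2 : t * (s + 1) <= d).
  { apply Rle_div_r; [lra|]. eapply Rle_trans; [apply Rmin_r|apply Rmin_l]. }
  assert (t3 : t * (M * s + 1) <= eps).
  { apply Rle_div_r; [unfold M; nra|]. eapply Rle_trans; [apply Rmin_r|apply Rmin_r]. }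
  rewrite (Cut t) by lra.
  assert (E : side z0 (line z0 z t) (line z0 z' t) = t * s).
  { unfold s, side.
    replace (line z0 z t - z0)%C with (RtoC t * (z - z0))%C by (unfold line; ring).
    replace (line z0 z' t - line z0 z t)%C with (RtoC t * (z' - z))%C by (unfold line; ring).
    replace (z0 - line z0 z' t)%C with (RtoC t * (z0 - z'))%C by (unfold line; ring).
    rewrite !Cmod_mult, !Cmod_R, !Rabs_pos_eq by lra. ring. }
  assert (Dp : forall y, Cmod (y - c) < R -> Cmod (line z0 y t - c) < R).
  { intros y Hy. apply (convex_disc c R); try easy. lra. }
  apply Rle_trans with (M * side z0 (line z0 z t) (line z0 z' t)).
  - apply tri_int_bound; try (apply SC; auto).
    assert (X : forall p q u, 0 <= u <= 1 -> Cmod (p - z0) + Cmod (q - p) <= t * s ->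
      Cmod (g (line p q u)) <= M).
    { intros p q u Hu Hpq.
      assert (L := line_dist p q z0 u Hu).
      assert (B : Cmod (line p q u - z0) < d) by nra.
      specialize (Hd0 _ B).
      assert (T := Cmod_triangle (g z0) (g (line p q u) - g z0)).
      replace (g z0 + (g (line p q u) - g z0))%C with (g (line p q u)) in T by ring.
      unfold M. lra. }
    rewrite <- E in X. unfold side in X.
    assert (P1 := Cmod_ge_0 (line z0 z t - z0)).
    assert (P2 := Cmod_ge_0 (line z0 z' t - line z0 z t)).
    assert (P3 := Cmod_ge_0 (z0 - line z0 z' t)).
    intros u Hu. repeat split; apply X; try easy.
    + replace (z0 - z0)%C with (RtoC 0) by ring. rewrite Cmod_0. lra.
    + lra.
    + rewrite (Cmod_swap (line z0 z' t) z0) .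
      assert (T := Cmod_triangle (line z0 z t - z0) (line z0 z' t - line z0 z t)).
      replace (line z0 z t - z0 + (line z0 z' t - line z0 z t))%C
        with (line z0 z' t - z0)%C in T by ring.
      rewrite (Cmod_swap (line z0 z' t) z0) in T. lra.
  - rewrite E. unfold M in *. nra.
Qed.

(** Integrating from the exceptional point [z0] itself, increments of the
    integral are integrals along short segments. *)
Theorem primitive_punctured (g : C -> C) (c z0 : C) (R : R) :
  (forall w, Cmod (w - c) < R -> ccont g w) ->
  (forall w, Cmod (w - c) < R -> w <> z0 -> cex g w) ->
  Cmod (z0 - c) < R ->
  forall z, Cmod (z - c) < R -> cderiv (seg_int g z0) z (g z).
Proof.
  intros Hc Hd D0 z D1.
  assert (SC : forall p q, Cmod (p - c) < R -> Cmod (q - c) < R -> segcont g p q).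
  { intros p q Hp Hq t Ht. apply Hc. now apply (convex_disc c R). }
  assert (Loc : exists d, 0 < d /\ forall w, Cmod (w - c) < R -> Cmod (w - z) < d ->
    tri_int g z0 z w = RtoC 0).
  { destruct (Ceq_dec z z0) as [->|N].
    - exists 1. split; [lra|]. intros w Hw _. unfold tri_int.
      rewrite seg_int_point, (seg_int_swap g z0 w) by now apply SC. ring.
    - assert (n0 : 0 < Cmod (z - z0)) by (apply Cmod_gt_0, Cminus_eq_contra, N).
      exists (Cmod (z - z0) / 2). split; [lra|]. intros w Hw Hwz.
      apply (tri_int_punctured g c z0 z w R); auto. lra. }
  destruct Loc as [d1 [d10 Hd1]].
  apply cderiv_eps. intros eps He.
  assert (C1 := Hc z D1). rewrite ccont_eps in C1. destruct (C1 eps He) as [d2 [d20 Hd2]].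
  exists (Rmin (R - Cmod (z - c)) (Rmin d1 d2)). split.
  { repeat apply Rmin_pos; lra. }
  intros w Hw.
  assert (W1 := Rlt_le_trans _ _ _ Hw (Rmin_l _ _)).
  assert (W23 := Rlt_le_trans _ _ _ Hw (Rmin_r _ _)).
  assert (W2 := Rlt_le_trans _ _ _ W23 (Rmin_l _ _)).
  assert (W3 := Rlt_le_trans _ _ _ W23 (Rmin_r _ _)).
  assert (Dw : Cmod (w - c) < R).
  { assert (T := Cmod_triangle (w - z) (z - c)).
    replace (w - z + (z - c))%C with (w - c)%C in T by ring. lra. }
  specialize (Hd1 w Dw W2). unfold tri_int in Hd1.
  rewrite (seg_int_swap g z0 w) in Hd1 by now apply SC.
  assert (K1 : segcont (fun _ => g z) z w) by (intros t _; apply ccont_const).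
  replace (seg_int g z0 w - seg_int g z0 z - g z * (w - z))%C
    with (seg_int (fun y => g y - g z)%C z w).
  - apply seg_int_bound.
    + intros t Ht. apply continuous_Cminus; [now apply SC|apply ccont_const].
    + intros t Ht. apply Rlt_le, Hd2.
      assert (L := line_dist z w z t Ht).
      replace (z - z)%C with (RtoC 0) in L by ring. rewrite Cmod_0 in L. lra.
  - rewrite seg_int_minus by (auto).
    rewrite (seg_int_primitive (fun y => g z * y)%C (fun _ => g z) z w K1).
    + replace (seg_int g z w) with (seg_int g z0 z + seg_int g z w + - seg_int g z0 w
        - seg_int g z0 z + seg_int g z0 w)%C by ring.
      rewrite Hd1. ring.
    + intros t _. apply (cderiv_eq _ _ (g z * 1)%C); [|ring].
      apply (cderiv_scal (g z) (fun y => y)), cderiv_id.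
Qed.

(** * Circles and Cauchy transforms *)

Definition circle_pt (c : C) (r t : R) : C := (c + RtoC r * (cos t, sin t))%C.

Lemma Cmod_cos_sin (t : R) : Cmod (cos t, sin t) = 1.
Proof.
  unfold Cmod. simpl. rewrite !Rmult_1_r, Rplus_comm.
  change (sin t * sin t + cos t * cos t) with (Rsqr (sin t) + Rsqr (cos t)).
  now rewrite sin2_cos2, sqrt_1.
Qed.

Lemma Cmod_circle_pt (c : C) (r t : R) : 0 <= r -> Cmod (circle_pt c r t - c) = r.
Proof.
  intros Hr. unfold circle_pt.
  replace (c + r * (cos t, sin t) - c)%C with (r * (cos t, sin t))%C by ring.
  rewrite Cmod_mult, Cmod_R, Cmod_cos_sin, Rabs_pos_eq by easy. ring.
Qed.

Lemma pderiv_circle_pt (c : C) (r t : R) : pderiv (circle_pt c r) t (Ci * (circle_pt c r t - c))%C.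
Proof.
  replace (Ci * (circle_pt c r t - c))%C with (- r * sin t, r * cos t).
  - apply pderiv_pair; simpl; auto_derive; trivial; ring.
  - unfold circle_pt, Ci, Cmult, Cplus, Cminus, Copp, RtoC. simpl. f_equal; ring.
Qed.

Lemma pcont_circle_pt (f : C -> C) (c : C) (r t : R) : ccont f (circle_pt c r t) ->
  pcont (fun t => f (circle_pt c r t)) t.
Proof.
  intros H. apply pcont_comp; [easy|]. apply (pderiv_cont _ _ _ (pderiv_circle_pt c r t)).
Qed.

Lemma circle_pt_2PI (c : C) (r : R) : circle_pt c r (2 * PI) = circle_pt c r 0.
Proof. unfold circle_pt. now rewrite cos_2PI, sin_2PI, cos_0, sin_0. Qed.

Lemma two_PI_pos : 0 <= 2 * PI.
Proof. assert (H := PI_RGT_0). lra. Qed.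

(** The integral of [f(w) dw] over the circle, divided by the factor [Ci]. *)
Definition circle_int (f : C -> C) (c : C) (r : R) : C :=
  CInt (fun t => f (circle_pt c r t) * (circle_pt c r t - c))%C 0 (2 * PI).

Lemma ccont_times_shift (f : C -> C) (c z : C) : ccont f z ->
  ccont (fun w => f w * (w - c))%C z.
Proof.
  intros H. apply continuous_Cmult; [easy|].
  apply continuous_Cminus; [apply ccont_id|apply ccont_const].
Qed.

Lemma ex_circle_int (f : C -> C) (c : C) (r : R) : (forall t, ccont f (circle_pt c r t)) ->
  ex_CInt (fun t => f (circle_pt c r t) * (circle_pt c r t - c))%C 0 (2 * PI).
Proof.
  intros H. apply ex_CInt_cont; [apply two_PI_pos|]. intros t _.
  apply (pcont_circle_pt (fun w => f w * (w - c))%C), ccont_times_shift, H.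
Qed.

Lemma circle_int_primitive (F f : C -> C) (c : C) (r : R) :
  (forall t, cderiv F (circle_pt c r t) (f (circle_pt c r t))) ->
  (forall t, ccont f (circle_pt c r t)) ->
  circle_int f c r = RtoC 0.
Proof.
  intros HF Hf.
  assert (X : (Ci * circle_int f c r)%C = RtoC 0).
  { unfold circle_int. rewrite <- CInt_Cmult.
    - replace (RtoC 0) with (F (circle_pt c r (2 * PI)) - F (circle_pt c r 0))%C
        by (rewrite circle_pt_2PI; ring).
      apply CInt_derive with (F := fun t => F (circle_pt c r t)); [apply two_PI_pos| |].
      + intros t _. 
        replace (Ci * (f (circle_pt c r t) * (circle_pt c r t - c)))%C
          with (f (circle_pt c r t) * (Ci * (circle_pt c r t - c)))%C by ring.
        apply pderiv_comp; [easy|apply pderiv_circle_pt].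
      + intros t _. apply (pcont_circle_pt (fun w => Ci * (f w * (w - c)))%C), continuous_Cmult;
          [apply ccont_const|now apply ccont_times_shift].
    - now apply ex_circle_int. }
  transitivity (- Ci * (Ci * circle_int f c r))%C; [|rewrite X; ring].
  rewrite Cmult_assoc. replace (- Ci * Ci)%C with (RtoC 1).
  - ring.
  - unfold Ci, Cmult, Copp, RtoC. simpl. f_equal; ring.
Qed.

(** Differentiation under the integral sign from a uniform second order bound on the
    increments, which spares any joint continuity. *)
Lemma CInt_param_derive (k : C -> R -> C) (k' : R -> C) (N : R -> R) (z : C) (a b d : R) :
  a <= b -> 0 < d ->
  (forall w, Cmod (w - z) < d -> ex_CInt (k w) a b) -> ex_CInt k' a b -> ex_RInt N a b ->
  (forall w t, Cmod (w - z) < d -> a <= t <= b ->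
    Cmod (k w t - k z t - k' t * (w - z)) <= Cmod (w - z) ^ 2 * N t) ->
  cderiv (fun w => CInt (k w) a b) z (CInt k' a b).
Proof.
  intros ab d0 Hk Hk' HN H. apply cderiv_eps. intros eps He.
  set (I := RInt N a b).
  assert (A0 := Rabs_pos I).
  exists (Rmin d (eps / (Rabs I + 1))). split.
  { apply Rmin_pos; [easy|]. apply Rdiv_lt_0_compat; lra. }
  intros w Hw.
  assert (W1 := Rlt_le_trans _ _ _ Hw (Rmin_l _ _)).
  assert (W2 := Rlt_le_trans _ _ _ Hw (Rmin_r _ _)).
  assert (Ez : ex_CInt (k z) a b).
  { apply Hk. replace (z - z)%C with (RtoC 0) by ring. now rewrite Cmod_0. }
  assert (Ew := Hk w W1).
  rewrite (Cmult_comm _ (w - z)), <- CInt_Cmult by easy.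
  assert (E' := ex_CInt_Cmult (w - z) _ _ _ Hk').
  rewrite <- CInt_minus by easy.
  assert (E1 : ex_CInt (fun t => k w t - k z t)%C a b)
    by exact (ex_RInt_minus (V := C_R_NormedModule) _ _ _ _ Ew Ez).
  rewrite <- CInt_minus by easy.
  eapply Rle_trans.
  - apply Cmod_CInt_le with (g := fun t => Cmod (w - z) ^ 2 * N t); [easy| | |].
    + intros t Ht. rewrite (Cmult_comm (w - z)). now apply H.
    + exact (ex_RInt_minus (V := C_R_NormedModule) _ _ _ _ E1 E').
    + now apply (ex_RInt_scal (V := R_NormedModule)).
  - assert (X : RInt (fun t => Cmod (w - z) ^ 2 * N t) a b = Cmod (w - z) ^ 2 * I)
      by exact (RInt_scal (V := R_CompleteNormedModule) N a b (Cmod (w - z) ^ 2) HN).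
    rewrite X.
    apply Rlt_div_r in W2; [|lra].
    assert (P := Cmod_ge_0 (w - z)). assert (Q := Rle_abs I). nra.
Qed.

Lemma circle_pt_far (c z : C) (r t : R) : Cmod (z - c) < r ->
  r - Cmod (z - c) <= Cmod (circle_pt c r t - z).
Proof.
  intros H. assert (Hr : 0 <= r) by (assert (P := Cmod_ge_0 (z - c)); lra).
  assert (T := Cmod_triangle (circle_pt c r t - z) (z - c)).
  replace (circle_pt c r t - z + (z - c))%C with (circle_pt c r t - c)%C in T by ring.
  rewrite Cmod_circle_pt in T by easy. lra.
Qed.

Lemma Cmod_lt_neq (a b : C) (m : R) : 0 < m -> m <= Cmod (a - b) -> (a - b)%C <> RtoC 0.
Proof. intros Hm H E. rewrite E, Cmod_0 in H. lra. Qed.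

Lemma circle_pt_neq (c z : C) (r t : R) : Cmod (z - c) < r -> (circle_pt c r t - z)%C <> RtoC 0.
Proof.
  intros H. apply (Cmod_lt_neq _ _ (r - Cmod (z - c))); [lra|now apply circle_pt_far].
Qed.

Lemma pcont_cauchy_kernel (g : R -> C) (c z : C) (r t : R) : pcont g t -> Cmod (z - c) < r ->
  pcont (fun t => g t / (circle_pt c r t - z))%C t.
Proof.
  intros Hg Hz. apply continuous_Cdiv; [easy| |now apply circle_pt_neq].
  apply (pcont_circle_pt (fun w => w - z)%C).
  apply continuous_Cminus; [apply ccont_id|apply ccont_const].
Qed.

Lemma disc_near (c z w : C) (r : R) :
  Cmod (w - z) < (r - Cmod (z - c)) / 2 -> Cmod (w - c) < r - (r - Cmod (z - c)) / 2.
Proof.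
  intros H. assert (T := Cmod_triangle (w - z) (z - c)).
  replace (w - z + (z - c))%C with (w - c)%C in T by ring. lra.
Qed.

Lemma ex_RInt_Cmod_scal (g : R -> C) (k a b : R) : a <= b -> (forall t, pcont g t) ->
  ex_RInt (fun t => k * Cmod (g t)) a b.
Proof.
  intros ab Hg. apply (ex_RInt_scal (V := R_NormedModule)).
  apply (ex_RInt_continuous (V := R_CompleteNormedModule)).
  intros t _. now apply continuous_Cmod.
Qed.

Lemma cauchy_transform_derive (g : R -> C) (c z : C) (r : R) :
  (forall t, pcont g t) -> Cmod (z - c) < r ->
  cderiv (fun z => CInt (fun t => g t / (circle_pt c r t - z))%C 0 (2 * PI)) z
    (CInt (fun t => g t / (circle_pt c r t - z) / (circle_pt c r t - z))%C 0 (2 * PI)).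
Proof.
  intros Hg Hz.
  set (m := (r - Cmod (z - c)) / 2).
  assert (m0 : 0 < m) by (unfold m; lra).
  apply (CInt_param_derive (fun z t => g t / (circle_pt c r t - z))%C _
    (fun t => / m ^ 3 * Cmod (g t)) z 0 (2 * PI) m); [apply two_PI_pos|easy| | | |].
  - intros w Hw. apply ex_CInt_cont; [apply two_PI_pos|]. intros t _.
    apply disc_near in Hw. apply pcont_cauchy_kernel; [easy|lra].
  - apply ex_CInt_cont; [apply two_PI_pos|]. intros t _.
    apply (pcont_cauchy_kernel (fun t => g t / (circle_pt c r t - z))%C); [now apply pcont_cauchy_kernel|lra].
  - apply ex_RInt_Cmod_scal; [apply two_PI_pos|easy].
  - intros w t Hw _. apply disc_near in Hw. fold m in Hw.
    assert (Fz := circle_pt_far c z r t Hz).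
    assert (Fw := circle_pt_far c w r t ltac:(lra)).
    assert (mz : m <= Cmod (circle_pt c r t - z)) by (unfold m in *; lra).
    assert (mw : m <= Cmod (circle_pt c r t - w)) by lra.
    assert (Nz := Cmod_lt_neq _ _ _ m0 mz). assert (Nw := Cmod_lt_neq _ _ _ m0 mw).
    set (p := circle_pt c r t) in *.
    replace (g t / (p - w) - g t / (p - z) - g t / (p - z) / (p - z) * (w - z))%C
      with ((w - z) ^ 2 * (/ ((p - z) * (p - z) * (p - w)) * g t))%C by (field; auto).
    rewrite Cmod_mult, Cmod_pow. apply Rmult_le_compat_l; [apply pow2_ge_0|].
    rewrite Cmod_mult. apply Rmult_le_compat_r; [apply Cmod_ge_0|].
    rewrite Cmod_inv by (repeat apply Cmult_neq_0; auto). rewrite !Cmod_mult.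
    apply Rinv_le_contravar; [now apply pow_lt|]. simpl. rewrite Rmult_1_r, <- Rmult_assoc.
    repeat apply Rmult_le_compat; nra.
Qed.

(** Differentiating a Cauchy transform a second time is what makes the derivative of a
    holomorphic function holomorphic. *)
Lemma ex_cauchy_transform_derive2 (g : R -> C) (c z : C) (r : R) :
  (forall t, pcont g t) -> Cmod (z - c) < r ->
  cex (fun z => CInt (fun t => g t / (circle_pt c r t - z) / (circle_pt c r t - z))%C 0 (2 * PI)) z.
Proof.
  intros Hg Hz.
  set (m := (r - Cmod (z - c)) / 2).
  assert (m0 : 0 < m) by (unfold m; lra).
  set (k' := fun t => (2 * (g t / (circle_pt c r t - z) / (circle_pt c r t - z) / (circle_pt c r t - z)))%C).
  exists (CInt k' 0 (2 * PI)).
  assert (C1 : forall w t, Cmod (w - c) < r ->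
    pcont (fun t => g t / (circle_pt c r t - w) / (circle_pt c r t - w))%C t).
  { intros w t Hw. apply (pcont_cauchy_kernel (fun t => g t / (circle_pt c r t - w))%C); [|easy].
    now apply pcont_cauchy_kernel. }
  apply (CInt_param_derive (fun z t => g t / (circle_pt c r t - z) / (circle_pt c r t - z))%C _
    (fun t => 3 / m ^ 4 * Cmod (g t)) z 0 (2 * PI) m); [apply two_PI_pos|easy| | | |].
  - intros w Hw. apply ex_CInt_cont; [apply two_PI_pos|]. intros t _.
    apply disc_near in Hw. apply C1. lra.
  - apply ex_CInt_cont; [apply two_PI_pos|]. intros t _. apply continuous_Cmult.
    + apply continuous_const.
    + apply (pcont_cauchy_kernel (fun t => g t / (circle_pt c r t - z) / (circle_pt c r t - z))%C); [|easy].
      now apply C1.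
  - apply ex_RInt_Cmod_scal; [apply two_PI_pos|easy].
  - intros w t Hw _. apply disc_near in Hw. fold m in Hw.
    assert (Fz := circle_pt_far c z r t Hz).
    assert (Fw := circle_pt_far c w r t ltac:(lra)).
    assert (mz : m <= Cmod (circle_pt c r t - z)) by (unfold m in *; lra).
    assert (mw : m <= Cmod (circle_pt c r t - w)) by lra.
    assert (Nz := Cmod_lt_neq _ _ _ m0 mz). assert (Nw := Cmod_lt_neq _ _ _ m0 mw).
    unfold k'. set (p := circle_pt c r t) in *.
    (* with u = p - z and v = p - w the remainder is (w - z)^2 (1/(uuvv) + 2/(uuuv)) *)
    replace (g t / (p - w) / (p - w) - g t / (p - z) / (p - z)
      - 2 * (g t / (p - z) / (p - z) / (p - z)) * (w - z))%C
      with ((w - z) ^ 2 * ((/ (p - z) * / (p - z) * / (p - w) * / (p - w)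
        + 2 * (/ (p - z) * / (p - z) * / (p - z) * / (p - w))) * g t))%C by (field; auto).
    rewrite Cmod_mult, Cmod_pow. apply Rmult_le_compat_l; [apply pow2_ge_0|].
    rewrite Cmod_mult. apply Rmult_le_compat_r; [apply Cmod_ge_0|].
    eapply Rle_trans; [apply Cmod_triangle|].
    rewrite !Cmod_mult, !Cmod_inv, Cmod_R, Rabs_pos_eq by (auto; lra).
    assert (Iz : 0 <= / Cmod (p - z) <= / m).
    { split; [apply Rlt_le, Rinv_0_lt_compat; lra|]. now apply Rinv_le_contravar. }
    assert (Iw : 0 <= / Cmod (p - w) <= / m).
    { split; [apply Rlt_le, Rinv_0_lt_compat; lra|]. now apply Rinv_le_contravar. }
    assert (M4 : forall x y u v : R, 0 <= x <= / m -> 0 <= y <= / m -> 0 <= u <= / m ->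
      0 <= v <= / m -> x * y * u * v <= / m ^ 4).
    { intros x y u v Hx Hy Hu Hv.
      replace (/ m ^ 4) with (/ m * / m * / m * / m) by (field; lra).
      repeat apply Rmult_le_compat; try apply Rmult_le_pos; try lra;
        apply Rmult_le_pos; lra. }
    unfold Rdiv. assert (Q1 := M4 _ _ _ _ Iz Iz Iw Iw). assert (Q2 := M4 _ _ _ _ Iz Iz Iz Iw).
    lra.
Qed.

(** * Cauchy's formula and its consequences *)

(** The derivative of the integral with respect to [z] vanishes, because 1/(w - z)^2
    has the primitive -1/(w - z) in [w]; and at the centre the integrand is 1. *)
Lemma winding (c z : C) (r : R) : Cmod (z - c) < r ->
  CInt (fun t => (circle_pt c r t - c) / (circle_pt c r t - z))%C 0 (2 * PI) = RtoC (2 * PI).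
Proof.
  intros Hz.
  assert (Hg : forall t, pcont (fun t => circle_pt c r t - c)%C t).
  { intros t. apply (pcont_circle_pt (fun w => w - c)%C).
    apply continuous_Cminus; [apply ccont_id|apply ccont_const]. }
  set (I := fun z => CInt (fun t => (circle_pt c r t - c) / (circle_pt c r t - z))%C 0 (2 * PI)).
  assert (r0 : 0 < r) by (assert (P := Cmod_ge_0 (z - c)); lra).
  assert (cc : Cmod (c - c) < r).
  { replace (c - c)%C with (RtoC 0) by ring. now rewrite Cmod_0. }
  assert (D : forall w, Cmod (w - c) < r -> cderiv I w (RtoC 0)).
  { intros w Hw. apply (cderiv_eq _ _ _ _ (cauchy_transform_derive _ c w r Hg Hw)).
    rewrite <- (circle_int_primitive (fun u => - (1) * / (u - w))%C (fun u => / (u - w) / (u - w))%C c r).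
    - apply CInt_ext; [apply two_PI_pos|]. intros t _. field. now apply circle_pt_neq.
    - intros t. assert (N := circle_pt_neq c w r t Hw).
      apply (cderiv_eq _ _ (- (1) * (- RtoC 1 / ((circle_pt c r t - w) * (circle_pt c r t - w))))%C);
        [|field; auto].
      apply (cderiv_scal _ (fun u => / (u - w))%C).
      apply (cderiv_inv (fun u => u - w)%C); [apply cderiv_shift|easy].
    - intros t. assert (N := circle_pt_neq c w r t Hw).
      assert (S : ccont (fun u => u - w)%C (circle_pt c r t))
        by (apply continuous_Cminus; [apply ccont_id|apply ccont_const]).
      apply continuous_Cdiv; [|easy|easy]. now apply continuous_Cinv. }
  assert (E : I (line c z 0) = I (line c z 1)).
  { apply (eq_is_derive (V := C_R_NormedModule) (fun t => I (line c z t))); [|lra].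
    intros t Ht. change (pderiv (fun t => I (line c z t)) t (RtoC 0)).
    replace (RtoC 0) with (0 * (z - c))%C by ring.
    apply pderiv_comp; [|apply pderiv_line]. apply D. now apply (convex_disc c r). }
  rewrite line_0, line_1 in E. fold (I z). rewrite <- E. unfold I.
  rewrite (CInt_ext _ (fun _ => RtoC 1)); [|apply two_PI_pos|].
  - rewrite CInt_const, Rminus_0_r. apply Cmult_1_r.
  - intros t _. field. now apply circle_pt_neq.
Qed.

Definition slope (f : C -> C) (a w : C) : C :=
  if Ceq_dec w a then C_derive f a else ((f w - f a) / (w - a))%C.

Lemma slope_diag (f : C -> C) (a : C) : slope f a a = C_derive f a.
Proof. unfold slope. now destruct (Ceq_dec a a). Qed.

Lemma slope_neq (f : C -> C) (a w : C) : w <> a -> slope f a w = ((f w - f a) / (w - a))%C.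
Proof. intros N. unfold slope. now destruct (Ceq_dec w a). Qed.

Lemma slope_cont (f : C -> C) (a : C) : cex f a -> ccont (slope f a) a.
Proof.
  intros H. apply cderiv_correct in H. rewrite cderiv_eps in H.
  apply ccont_eps. intros eps He. destruct (H (eps / 2) ltac:(lra)) as [d [d0 Hd]].
  exists d. split; [easy|]. intros w Hw. rewrite slope_diag.
  destruct (Ceq_dec w a) as [->|N].
  - rewrite slope_diag. replace (_ - _)%C with (RtoC 0) by ring. now rewrite Cmod_0.
  - rewrite slope_neq by easy.
    assert (N' := Cminus_eq_contra _ _ N).
    assert (P := proj1 (Cmod_gt_0 _) N').
    replace ((f w - f a) / (w - a) - C_derive f a)%C with
      ((f w - f a - C_derive f a * (w - a)) / (w - a))%C by (field; auto).
    rewrite Cmod_div by easy. apply Rlt_div_l; [easy|].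
    eapply Rle_lt_trans; [apply Hd, Hw|]. nra.
Qed.

Lemma slope_cex (f : C -> C) (a w : C) : cex f w -> w <> a -> cex (slope f a) w.
Proof.
  intros [l Hl] N. assert (N' := Cminus_eq_contra _ _ N).
  eexists. apply (cderiv_ext_loc (fun u => (f u - f a) / (u - a))%C _ _ _ (Cmod (w - a))).
  - now apply Cmod_gt_0.
  - intros u Hu. symmetry. apply slope_neq. intros ->. rewrite Cmod_swap in Hu. lra.
  - apply cderiv_div; [|apply cderiv_shift|easy].
    exact (cderiv_minus f (fun _ => f a) w _ _ Hl (cderiv_const _ _)).
Qed.

(** The difference quotient, completed by the derivative, is continuous at [a] and
    holomorphic elsewhere: the case for which an exceptional point is needed. *)
Lemma slope_primitive (f : C -> C) (c a : C) (R : R) :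
  (forall w, Cmod (w - c) < R -> cex f w) -> Cmod (a - c) < R ->
  forall w, Cmod (w - c) < R -> cderiv (seg_int (slope f a) a) w (slope f a w).
Proof.
  intros Hf Ha. apply primitive_punctured; [| |easy].
  - intros w Hw. destruct (Ceq_dec w a) as [->|N].
    + now apply slope_cont, Hf.
    + apply cex_cont. apply slope_cex; auto.
  - intros w Hw N. apply slope_cex; auto.
Qed.

Lemma circle_pt_in_disc (c : C) (r R t : R) : 0 <= r -> r < R -> Cmod (circle_pt c r t - c) < R.
Proof. intros r0 H. now rewrite Cmod_circle_pt. Qed.

(** The slope of [f] at [z] has a primitive, so its integral over the circle vanishes; the
    two parts of the slope give the two sides of the formula. *)
Theorem cauchy_formula (f : C -> C) (c z : C) (r R : R) :
  (forall w, Cmod (w - c) < R -> cex f w) -> Cmod (z - c) < r -> r < R ->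
  CInt (fun t => f (circle_pt c r t) * (circle_pt c r t - c) / (circle_pt c r t - z))%C 0 (2 * PI)
    = (RtoC (2 * PI) * f z)%C.
Proof.
  intros Hf Hz HR.
  assert (r0 : 0 <= r) by (assert (P := Cmod_ge_0 (z - c)); lra).
  assert (HD := fun t => circle_pt_in_disc c r R t r0 HR).
  assert (Hg : forall t, pcont (fun t => f (circle_pt c r t) * (circle_pt c r t - c))%C t).
  { intros t. apply (pcont_circle_pt (fun w => f w * (w - c))%C), ccont_times_shift, cex_cont; auto. }
  assert (H1 : forall t, pcont (fun t => circle_pt c r t - c)%C t).
  { intros t. apply (pcont_circle_pt (fun w => w - c)%C).
    apply continuous_Cminus; [apply ccont_id|apply ccont_const]. }
  assert (L : circle_int (slope f z) c r = RtoC 0).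
  { apply (circle_int_primitive (seg_int (slope f z) z)).
    - intros t. apply (slope_primitive f c z R); auto. lra.
    - intros t. apply cex_cont, slope_cex; auto. intros E.
      apply (circle_pt_neq c z r t Hz). rewrite E. ring. }
  unfold circle_int in L.
  rewrite (CInt_ext _ (fun t => f (circle_pt c r t) * (circle_pt c r t - c) / (circle_pt c r t - z)
    - f z * ((circle_pt c r t - c) / (circle_pt c r t - z)))%C) in L; [|apply two_PI_pos|].
  - assert (E1 : ex_CInt (fun t => f (circle_pt c r t) * (circle_pt c r t - c) / (circle_pt c r t - z))%C 0 (2 * PI)).
    { apply ex_CInt_cont; [apply two_PI_pos|]. intros t _. now apply pcont_cauchy_kernel. }
    assert (E2 : ex_CInt (fun t => (circle_pt c r t - c) / (circle_pt c r t - z))%C 0 (2 * PI)).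
    { apply ex_CInt_cont; [apply two_PI_pos|]. intros t _. now apply pcont_cauchy_kernel. }
    rewrite CInt_minus, CInt_Cmult, winding in L; try easy; [|now apply ex_CInt_Cmult].
    apply Ceq_minus. rewrite <- L. ring.
  - intros t _. assert (N := circle_pt_neq c z r t Hz).
    rewrite slope_neq.
    + field. easy.
    + intros E. apply N. rewrite E. ring.
Qed.

(** By Cauchy's formula [f] is a Cauchy transform on a smaller disc, and these can be
    differentiated twice. *)
Theorem holo_C_derive (f : C -> C) (c : C) (R : R) :
  (forall w, Cmod (w - c) < R -> cex f w) ->
  forall w, Cmod (w - c) < R -> cex (C_derive f) w.
Proof.
  intros Hf z Hz.
  set (r := (R + Cmod (z - c)) / 2).
  assert (Hr : Cmod (z - c) < r < R) by (unfold r; lra).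
  assert (r0 : 0 <= r) by (assert (P := Cmod_ge_0 (z - c)); lra).
  assert (HD := fun t => circle_pt_in_disc c r R t r0 (proj2 Hr)).
  set (g := fun t => (f (circle_pt c r t) * (circle_pt c r t - c))%C).
  assert (Hg : forall t, pcont g t).
  { intros t. apply (pcont_circle_pt (fun w => f w * (w - c))%C), ccont_times_shift, cex_cont; auto. }
  assert (P0 : RtoC (2 * PI) <> RtoC 0).
  { intros E. apply RtoC_inj in E. assert (H := PI_RGT_0). lra. }
  assert (In : forall w u, Cmod (w - c) < r -> Cmod (u - w) < r - Cmod (w - c) -> Cmod (u - c) < r).
  { intros w u Hw Hu. assert (T := Cmod_triangle (u - w) (w - c)).
    replace (u - w + (w - c))%C with (u - c)%C in T by ring. lra. }
  assert (D : forall w, Cmod (w - c) < r -> (/ RtoC (2 * PI)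
    * CInt (fun t => g t / (circle_pt c r t - w) / (circle_pt c r t - w))%C 0 (2 * PI))%C = C_derive f w).
  { intros w Hw. symmetry. apply is_C_derive_unique.
    apply (cderiv_ext_loc (fun u => / RtoC (2 * PI)
      * CInt (fun t => g t / (circle_pt c r t - u))%C 0 (2 * PI))%C _ _ _ (r - Cmod (w - c))); [lra| |].
    - intros u Hu. unfold g. rewrite (cauchy_formula f c u r R); try easy.
      + now field.
      + now apply (In w).
    - apply (cderiv_scal _ (fun u => CInt (fun t => g t / (circle_pt c r t - u))%C 0 (2 * PI))).
      now apply cauchy_transform_derive. }
  destruct (ex_cauchy_transform_derive2 g c z r Hg (proj1 Hr)) as [l Hl].
  exists (/ RtoC (2 * PI) * l)%C.
  apply (cderiv_ext_loc (fun u => / RtoC (2 * PI)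
    * CInt (fun t => g t / (circle_pt c r t - u) / (circle_pt c r t - u))%C 0 (2 * PI))%C _ _ _
    (r - Cmod (z - c))); [lra| |].
  - intros u Hu. apply D. now apply (In z).
  - now apply (cderiv_scal _ (fun u =>
      CInt (fun t => g t / (circle_pt c r t - u) / (circle_pt c r t - u))%C 0 (2 * PI))).
Qed.

(** The quotient is the slope of [f] at [a].  It has a primitive near [a], hence is the
    derivative of a holomorphic function and so holomorphic at [a] too. *)
Lemma entire_factor (f : C -> C) (a : C) : entire f -> f a = RtoC 0 ->
  exists g, entire g /\ (forall z, f z = (z - a) * g z)%C.
Proof.
  intros Hf Ha. exists (slope f a). split.
  - intros w. destruct (Ceq_dec w a) as [->|N]; [|now apply slope_cex].
    assert (H := slope_primitive f a a 1 (fun w _ => Hf w)).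
    assert (D0 : Cmod (a - a) < 1).
    { replace (a - a)%C with (RtoC 0) by ring. rewrite Cmod_0. lra. }
    specialize (H D0).
    assert (G : cex (C_derive (seg_int (slope f a) a)) a).
    { apply (holo_C_derive _ a 1); [|easy]. intros w Hw. exists (slope f a w). now apply H. }
    destruct G as [l Hl]. exists l.
    apply (cderiv_ext_loc (C_derive (seg_int (slope f a) a)) _ _ _ 1); [lra| |exact Hl].
    intros w Hw. apply is_C_derive_unique. now apply H.
  - intros z. destruct (Ceq_dec z a) as [->|N].
    + rewrite Ha. ring.
    + rewrite slope_neq, Ha by easy. field. now apply Cminus_eq_contra.
Qed.

Lemma Cmod2_pair (z : C) : Cmod z ^ 2 = fst z ^ 2 + snd z ^ 2.
Proof. apply Cmod2_alt. Qed.

(** Harmonic functions on a disc, given through a holomorphic function of which they are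
    the real part, as Cauchy's formula applies to the latter. *)
Definition re_holomorphic (u : C -> R) (c : C) (R : R) : Prop :=
  exists h : C -> C, forall z, Cmod (z - c) < R -> cex h z /\ u z = Re (h z).

(** A logarithm of [q] is a primitive [h] of [q'/q].  That [|q|^2 exp(-2 Re h)] is constant
    follows by differentiating it along rays, which avoids the complex exponential. *)
Theorem re_holomorphic_ln_Cmod (q : C -> C) (c : C) (R : R) :
  (forall z, Cmod (z - c) < R -> cex q z /\ q z <> RtoC 0) ->
  re_holomorphic (fun z => ln (Cmod (q z))) c R.
Proof.
  intros Hq.
  destruct (Rle_dec R 0) as [N|N].
  { exists q. intros z Hz. assert (P := Cmod_ge_0 (z - c)). lra. }
  set (k := fun z => (C_derive q z / q z)%C).
  assert (Dk : forall z, Cmod (z - c) < R -> cex k z).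
  { intros z Hz. destruct (holo_C_derive q c R (fun w Hw => proj1 (Hq w Hw)) z Hz) as [l Hl].
    destruct (Hq z Hz) as [[m Hm] Q0]. exact (ex_intro _ _ (cderiv_div (C_derive q) q z l m Hl Hm Q0)). }
  assert (D0 : Cmod (c - c) < R).
  { replace (c - c)%C with (RtoC 0) by ring. rewrite Cmod_0. lra. }
  set (h := seg_int k c).
  assert (Dh : forall z, Cmod (z - c) < R -> cderiv h z (k z)).
  { apply primitive_punctured; auto. intros w Hw. apply cex_cont; auto. }
  exists (fun z => RtoC (ln (Cmod (q c))) + h z)%C. intros z Hz. split.
  { exists (RtoC 0 + k z)%C. apply cderiv_plus; [apply cderiv_const|now apply Dh]. }
  rewrite re_plus. change (Re (RtoC ?x)) with x.
  set (phi := fun t => (fst (q (line c z t)) ^ 2 + snd (q (line c z t)) ^ 2)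
    * exp (- 2 * fst (h (line c z t)))).
  assert (E : phi 0 = phi 1).
  { apply (eq_is_derive (V := R_NormedModule) phi); [|lra].
    intros t Ht. assert (Dt : Cmod (line c z t - c) < R) by now apply (convex_disc c R).
    destruct (Hq _ Dt) as [Q1 Q0]. apply cderiv_correct in Q1.
    assert (Pq := pderiv_comp _ _ t _ _ Q1 (pderiv_line c z t)).
    assert (Ph := pderiv_comp _ _ t _ _ (Dh _ Dt) (pderiv_line c z t)).
    assert (F1 := pderiv_fst _ _ _ Pq). assert (F2 := pderiv_snd _ _ _ Pq).
    assert (F3 := pderiv_fst _ _ _ Ph).
    set (l := (C_derive q (line c z t) * (z - c))%C) in *.
    assert (K : (k (line c z t) * (z - c))%C = (l / q (line c z t))%C)
      by (unfold k, l; now field).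
    rewrite K in F3. unfold phi.
    set (A := fun t => fst (q (line c z t))) in *.
    set (B := fun t => snd (q (line c z t))) in *.
    set (H := fun t => fst (h (line c z t))) in *.
    change (is_derive (fun t => (A t ^ 2 + B t ^ 2) * exp (- 2 * H t)) t 0).
    assert (EA : ex_derive A t) by exact (ex_intro _ _ F1).
    assert (EB : ex_derive B t) by exact (ex_intro _ _ F2).
    assert (EH : ex_derive H t) by exact (ex_intro _ _ F3).
    auto_derive; [easy|].
    assert (U1 := is_derive_unique A t _ F1). assert (U2 := is_derive_unique B t _ F2).
    assert (U3 := is_derive_unique H t _ F3).
    change (Derive (fun x => A x) t) with (Derive A t).
    change (Derive (fun x => B x) t) with (Derive B t).
    change (Derive (fun x => H x) t) with (Derive H t).
    rewrite U1, U2, U3.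
    assert (X : fst (l / q (line c z t))%C * (A t ^ 2 + B t ^ 2) = A t * fst l + B t * snd l).
    { unfold A, B. destruct (q (line c z t)) as [x y] eqn:Eq. destruct l as [p s].
      assert (S : x * x + y * y <> 0).
      { intros S. apply Q0. assert (x = 0) by nra. assert (y = 0) by nra. now subst. }
      simpl. field. replace (x ^ 2 + y ^ 2) with (x * x + y * y) by ring. easy. }
    transitivity (2 * exp (- 2 * H t) * (A t * fst l + B t * snd l
      - fst (l / q (line c z t))%C * (A t ^ 2 + B t ^ 2))); [ring|]. rewrite X. ring. }
  unfold phi in E. rewrite line_0, line_1, <- !Cmod2_pair in E.
  assert (h0 : h c = RtoC 0) by apply seg_int_point.
  rewrite h0 in E. change (fst (RtoC 0)) with 0 in E. rewrite Rmult_0_r, exp_0, Rmult_1_r in E.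
  assert (P1 : 0 < Cmod (q c)) by (apply Cmod_gt_0; now apply Hq).
  assert (P2 : 0 < Cmod (q z)) by (apply Cmod_gt_0; now apply Hq).
  assert (L : ln (Cmod (q c) ^ 2) = ln (Cmod (q z) ^ 2 * exp (- 2 * fst (h z)))) by now rewrite E.
  rewrite ln_mult, ln_exp, !ln_pow in L; try apply exp_pos; try apply pow_lt; try easy.
  simpl INR in L. unfold Re. lra.
Qed.

(** * Poisson's formula and Harnack's inequalities *)

Definition poisson (c : C) (r : R) (z w : C) : R :=
  (r ^ 2 - Cmod (z - c) ^ 2) / Cmod (w - z) ^ 2.

Lemma RtoC_Cmod2 (z : C) : RtoC (Cmod z ^ 2) = (z * Cconj z)%C.
Proof. apply Cmod2_conj. Qed.

(** With o = w - c and y = z - c, add to Cauchy's formula at [z] the one at the centre [c]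
    for the function h(w) * conj(y) * o / (r^2 - conj(y) * o), which vanishes at [c].  On the circle
    r^2 = o * conj(o), and the two kernels add up to the Poisson kernel. *)
Lemma poisson_formula_C (h : C -> C) (c z : C) (r R : R) :
  (forall w, Cmod (w - c) < R -> cex h w) -> Cmod (z - c) < r -> r < R ->
  CInt (fun t => h (circle_pt c r t) * RtoC (poisson c r z (circle_pt c r t)))%C 0 (2 * PI)
    = (RtoC (2 * PI) * h z)%C.
Proof.
  intros Hh Hz HR.
  set (s := Cmod (z - c)) in *.
  assert (s0 : 0 <= s) by apply Cmod_ge_0.
  assert (r0 : 0 < r) by lra.
  set (zc := Cconj (z - c)).
  (* any radius strictly between r and r^2 / s would do in place of the second one;
     this form also covers s = 0 *)
  set (R' := Rmin R (2 * r ^ 2 / (r + s))).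
  assert (HR' : r < R').
  { apply Rmin_glb_lt; [easy|]. apply Rlt_div_r; nra. }
  assert (Den : forall w, Cmod (w - c) < R' -> (RtoC (r ^ 2) - zc * (w - c))%C <> RtoC 0).
  { intros w Hw E.
    assert (W : Cmod (w - c) < 2 * r ^ 2 / (r + s))
      by (eapply Rlt_le_trans; [exact Hw|apply Rmin_r]).
    assert (E' : RtoC (r ^ 2) = (zc * (w - c))%C) by (apply Ceq_minus, E).
    apply (f_equal Cmod) in E'. unfold zc in E'.
    rewrite Cmod_mult, Cmod_conj, Cmod_R, Rabs_pos_eq in E' by apply pow2_ge_0. fold s in E'.
    apply Rlt_div_r in W; [|lra]. assert (P := Cmod_ge_0 (w - c)). nra. }
  set (m := fun w => (h w * (zc * (w - c) / (RtoC (r ^ 2) - zc * (w - c))))%C).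
  assert (Hm : forall w, Cmod (w - c) < R' -> cex m w).
  { intros w Hw. destruct (Hh w) as [l Hl].
    { eapply Rlt_le_trans; [exact Hw|apply Rmin_l]. }
    assert (D1 := cderiv_scal zc (fun u => u - c)%C w _ (cderiv_shift c w)).
    assert (D2 := cderiv_minus (fun _ => RtoC (r ^ 2)) _ w _ _ (cderiv_const _ _) D1).
    assert (D3 := cderiv_div _ _ w _ _ D1 D2 (Den w Hw)).
    exact (ex_intro _ _ (cderiv_mult h _ w _ _ Hl D3)). }
  assert (cc : Cmod (c - c) < r).
  { replace (c - c)%C with (RtoC 0) by ring. now rewrite Cmod_0. }
  assert (F1 := cauchy_formula h c z r R Hh Hz HR).
  assert (F2 := cauchy_formula m c c r R' Hm cc HR').
  assert (m0 : m c = RtoC 0).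
  { unfold m. replace (c - c)%C with (RtoC 0) by ring.
    replace (RtoC (r ^ 2) - zc * 0)%C with (RtoC (r ^ 2)) by ring.
    field. intros E. apply RtoC_inj in E. nra. }
  rewrite m0, Cmult_0_r in F2.
  assert (HD : forall t R, r < R -> Cmod (circle_pt c r t - c) < R)
    by (intros; apply circle_pt_in_disc; lra).
  assert (E1 : ex_CInt (fun t => h (circle_pt c r t) * (circle_pt c r t - c) / (circle_pt c r t - z))%C 0 (2 * PI)).
  { apply ex_CInt_cont; [apply two_PI_pos|]. intros t _. apply pcont_cauchy_kernel; [|easy].
    apply (pcont_circle_pt (fun w => h w * (w - c))%C), ccont_times_shift, cex_cont; auto. }
  assert (E2 : ex_CInt (fun t => m (circle_pt c r t) * (circle_pt c r t - c) / (circle_pt c r t - c))%C 0 (2 * PI)).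
  { apply ex_CInt_cont; [apply two_PI_pos|]. intros t _. apply pcont_cauchy_kernel; [|easy].
    apply (pcont_circle_pt (fun w => m w * (w - c))%C), ccont_times_shift, cex_cont; auto. }
  transitivity (RtoC (2 * PI) * h z + 0)%C; [|apply Cplus_0_r].
  rewrite <- F1, <- F2, <- CInt_plus by easy.
  apply CInt_ext; [apply two_PI_pos|]. intros t _.
  assert (Nz := circle_pt_neq c z r t Hz). assert (Nc := circle_pt_neq c c r t cc).
  assert (Nd := Den _ (HD t R' HR')).
  assert (Er : RtoC (r ^ 2) = ((circle_pt c r t - c) * Cconj (circle_pt c r t - c))%C).
  { rewrite <- RtoC_Cmod2, Cmod_circle_pt by lra. easy. }
  assert (Nz' : Cconj (circle_pt c r t - z) <> RtoC 0).
  { intros E. apply Nz. apply Cmod_eq_0. rewrite <- Cmod_conj, E. apply Cmod_0. }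
  unfold m, poisson. 
  rewrite RtoC_div by (apply pow_nonzero; intros E; now apply Nz, Cmod_eq_0).
  rewrite RtoC_minus, !RtoC_Cmod2. fold zc.
  rewrite Er in *. set (w := circle_pt c r t) in *.
  assert (Ez : Cconj (w - z) = (Cconj (w - c) - zc)%C).
  { unfold zc. rewrite <- Cminus_conj. f_equal. ring. }
  assert (Ez2 : (w - z)%C = ((w - c) - (z - c))%C) by ring.
  rewrite Ez in *. rewrite Ez2 in *.
  set (o := (w - c)%C) in *. set (o' := Cconj o) in *. set (y := (z - c)%C) in *.
  field. repeat split; try easy.
Qed.

Theorem poisson_formula (u : C -> R) (c z : C) (r R : R) :
  re_holomorphic u c R -> Cmod (z - c) < r -> r < R ->
  is_RInt (fun t => u (circle_pt c r t) * poisson c r z (circle_pt c r t)) 0 (2 * PI) (2 * PI * u z).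
Proof.
  intros [h Hh] Hz HR.
  assert (Hh1 := fun w Hw => proj1 (Hh w Hw)).
  assert (s0 := Cmod_ge_0 (z - c)).
  assert (HD := fun t => circle_pt_in_disc c r R t ltac:(lra) HR).
  assert (Ex : ex_CInt (fun t => h (circle_pt c r t) * RtoC (poisson c r z (circle_pt c r t)))%C 0 (2 * PI)).
  { apply ex_CInt_cont; [apply two_PI_pos|]. intros t _. apply continuous_Cmult.
    - apply pcont_circle_pt, cex_cont; auto.
    - apply (continuous_comp (fun t => poisson c r z (circle_pt c r t)) RtoC).
      + unfold poisson, Rdiv. apply (continuous_mult (K := R_AbsRing)); [apply continuous_const|].
        apply (continuous_comp _ Rinv).
        * apply (continuous_comp (fun t => Cmod (circle_pt c r t - z)) (fun x => x ^ 2)).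
          -- apply continuous_Cmod, (pcont_circle_pt (fun w => w - z)%C).
             apply continuous_Cminus; [apply ccont_id|apply ccont_const].
          -- apply (ex_derive_continuous (V := R_NormedModule)). auto_derive. easy.
        * apply continuous_Rinv. apply pow_nonzero. intros E.
          now apply (circle_pt_neq c z r t Hz), Cmod_eq_0.
      + apply (pderiv_cont RtoC _ (RtoC 1)). apply pderiv_pair; simpl; auto_derive; easy. }
  assert (X := is_RInt_fct_extend_fst (U := R_NormedModule) (V := R_NormedModule) _ _ _ _
    (RInt_correct (V := C_R_CompleteNormedModule) _ _ _ Ex)).
  rewrite poisson_formula_C with (R := R) in X by easy.
  replace (2 * PI * u z) with (fst (RtoC (2 * PI) * h z)%C).
  - eapply is_RInt_ext; [|exact X]. intros t _. cbv beta.
    rewrite (proj2 (Hh _ (HD t))). apply re_scal_r.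
  - rewrite (proj2 (Hh z ltac:(lra))). apply re_scal_l.
Qed.

Lemma poisson_centre (c w : C) (r : R) : 0 < r -> Cmod (w - c) = r -> poisson c r c w = 1.
Proof.
  intros r0 H. unfold poisson. replace (c - c)%C with (RtoC 0) by ring.
  rewrite Cmod_0, H. field. lra.
Qed.

Lemma mean_value (u : C -> R) (c : C) (r R : R) : re_holomorphic u c R -> 0 < r -> r < R ->
  is_RInt (fun t => u (circle_pt c r t)) 0 (2 * PI) (2 * PI * u c).
Proof.
  intros H r0 HR. eapply is_RInt_ext; [|apply (poisson_formula u c c r R); try easy].
  - intros t _. cbv beta. rewrite poisson_centre; [apply Rmult_1_r|easy|]. apply Cmod_circle_pt. lra.
  - replace (c - c)%C with (RtoC 0) by ring. now rewrite Cmod_0.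
Qed.

(** The Poisson kernel is at least (r - s)/(r + s) with s = |z - c|. *)
Theorem harnack (u : C -> R) (c z : C) (r R : R) :
  re_holomorphic u c R -> Cmod (z - c) < r -> r < R -> (forall t, 0 <= u (circle_pt c r t)) ->
  (r - Cmod (z - c)) / (r + Cmod (z - c)) * u c <= u z.
Proof.
  intros H Hz HR H0. set (s := Cmod (z - c)) in *.
  assert (s0 : 0 <= s) by apply Cmod_ge_0.
  assert (M := mean_value u c r R H ltac:(lra) HR).
  assert (P := poisson_formula u c z r R H Hz HR).
  apply (is_RInt_scal (V := R_NormedModule) _ _ _ ((r - s) / (r + s))) in M.
  assert (L : scal ((r - s) / (r + s)) (2 * PI * u c) <= 2 * PI * u z).
  { apply (is_RInt_le _ _ 0 (2 * PI) _ _ two_PI_pos M P). intros t _.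
    change (scal ?x ?y) with (x * y). rewrite Rmult_comm.
    apply Rmult_le_compat_l; [apply H0|].
    assert (F := circle_pt_far c z r t Hz). fold s in F.
    assert (T := Cmod_triangle (circle_pt c r t - c) (c - z)).
    replace (circle_pt c r t - c + (c - z))%C with (circle_pt c r t - z)%C in T by ring.
    rewrite Cmod_circle_pt, (Cmod_swap c z) in T by lra. fold s in T.
    unfold poisson. fold s. set (a := Cmod (circle_pt c r t - z)) in *.
    apply Rle_div_l; [lra|].
    replace ((r ^ 2 - s ^ 2) / a ^ 2 * (r + s)) with ((r - s) * ((r + s) ^ 2 / a ^ 2))
      by (field; lra).
    rewrite <- (Rmult_1_r (r - s)) at 1. apply Rmult_le_compat_l; [lra|].
    apply Rle_div_r; nra. }
  change (scal ?x ?y) with (x * y) in L.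
  assert (Q := PI_RGT_0). apply Rmult_le_reg_l with (2 * PI); [lra|].
  rewrite <- Rmult_assoc, (Rmult_comm (2 * PI)), Rmult_assoc. exact L.
Qed.

Lemma parallelogram (w z : C) :
  Cmod (w - z) ^ 2 + Cmod (w + z) ^ 2 = 2 * (Cmod w ^ 2 + Cmod z ^ 2).
Proof. rewrite !Cmod2_pair. destruct w as [a b], z as [x y]. simpl. ring. Qed.

(** The sum of the Poisson kernels at [z] and [-z] is at most twice
    (r^2 + s^2)/(r^2 - s^2) with s = |z|: of second order in s, whereas a single kernel
    exceeds 1 by a term of first order. *)
Theorem harnack_symmetric (u : C -> R) (z : C) (r R : R) :
  re_holomorphic u 0 R -> Cmod z < r -> r < R -> (forall t, 0 <= u (circle_pt 0 r t)) ->
  u z + u (- z)%C <= 2 * (r ^ 2 + Cmod z ^ 2) / (r ^ 2 - Cmod z ^ 2) * u 0.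
Proof.
  intros H Hz HR H0. set (s := Cmod z) in *.
  assert (s0 : 0 <= s) by apply Cmod_ge_0.
  assert (Z1 : (z - 0)%C = z) by ring. assert (Z2 : (- z - 0)%C = (- z)%C) by ring.
  assert (Hz1 : Cmod (z - 0) < r) by (rewrite Z1; easy).
  assert (Hz2 : Cmod (- z - 0) < r) by (rewrite Z2, Cmod_opp; easy).
  assert (M := mean_value u 0 r R H ltac:(lra) HR).
  assert (P1 := poisson_formula u 0 z r R H Hz1 HR).
  assert (P2 := poisson_formula u 0 (- z)%C r R H Hz2 HR).
  assert (P := is_RInt_plus (V := R_NormedModule) _ _ _ _ _ _ P1 P2).
  set (k := 2 * (r ^ 2 + s ^ 2) / (r ^ 2 - s ^ 2)).
  apply (is_RInt_scal (V := R_NormedModule) _ _ _ k) in M.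
  assert (L : plus (2 * PI * u z) (2 * PI * u (- z)%C) <= scal k (2 * PI * u 0)).
  { apply (is_RInt_le _ _ 0 (2 * PI) _ _ two_PI_pos P M). intros t _.
    change (scal ?x ?y) with (x * y). change (plus ?x ?y) with (x + y).
    rewrite <- Rmult_plus_distr_l, (Rmult_comm k).
    apply Rmult_le_compat_l; [apply H0|].
    unfold poisson. rewrite Z1, Z2, Cmod_opp. fold s.
    assert (F1 := circle_pt_far 0 z r t Hz1). rewrite Z1 in F1. fold s in F1.
    assert (F2 := circle_pt_far 0 (- z) r t Hz2). rewrite Z2, Cmod_opp in F2. fold s in F2.
    set (w := circle_pt 0 r t) in *.
    assert (Ww : Cmod w = r).
    { rewrite <- (Cmod_circle_pt 0 r t) by lra. fold w. f_equal. ring. }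
    assert (W : (w - - z)%C = (w + z)%C) by ring. rewrite W in *.
    assert (Par := parallelogram w z). rewrite Ww in Par. fold s in Par.
    assert (Pr : r ^ 2 - s ^ 2 <= Cmod (w - z) * Cmod (w + z)).
    { rewrite <- Cmod_mult.
      assert (T := Cmod_triangle ((w - z) * (w + z)) (z * z)).
      replace ((w - z) * (w + z) + z * z)%C with (w * w)%C in T by ring.
      rewrite (Cmod_mult w w), (Cmod_mult z z), Ww in T. fold s in T. nra. }
    set (a := Cmod (w - z)) in *. set (b := Cmod (w + z)) in *.
    assert (rs : 0 < r ^ 2 - s ^ 2) by nra.
    replace ((r ^ 2 - s ^ 2) / a ^ 2 + (r ^ 2 - s ^ 2) / b ^ 2)
      with ((r ^ 2 - s ^ 2) * (a ^ 2 + b ^ 2) / (a * b) ^ 2) by (field; lra).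
    rewrite Par. unfold k.
    assert (ab : (r ^ 2 - s ^ 2) ^ 2 <= (a * b) ^ 2) by (apply pow_incr; lra).
    apply Rle_div_l; [apply pow_lt; nra|].
    replace (2 * (r ^ 2 + s ^ 2) / (r ^ 2 - s ^ 2) * (a * b) ^ 2)
      with (2 * (r ^ 2 + s ^ 2) * ((a * b) ^ 2 / (r ^ 2 - s ^ 2))) by (field; lra).
    rewrite (Rmult_comm (r ^ 2 - s ^ 2)). apply Rmult_le_compat_l; [nra|].
    apply Rle_div_r; [easy|]. nra. }
  change (scal ?x ?y) with (x * y) in L. change (plus ?x ?y) with (x + y) in L.
  assert (Q := PI_RGT_0). apply Rmult_le_reg_l with (2 * PI); [lra|].
  fold k. lra.
Qed.

Lemma re_holomorphic_const_minus (u : C -> R) (c : C) (R k : R) : re_holomorphic u c R -> re_holomorphic (fun z => k - u z) c R.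
Proof.
  intros [h Hh]. exists (fun z => RtoC k - h z)%C. intros z Hz.
  destruct (Hh z Hz) as [[l Hl] E]. split.
  - eexists. apply cderiv_minus; [apply cderiv_const|exact Hl].
  - unfold Cminus. rewrite re_plus, re_opp, E. reflexivity.
Qed.

(** * Entire functions with bounded spherical derivative have exponential type *)

(** With G = 1 + |f|^2, the derivative of -1/G along the segment is at most
    2 |f| |f'| |b - a| / G^2 <= M |b - a|, since 2 |f| <= G. *)
Lemma spherical_segment (f : C -> C) (M : R) (a b : C) : entire f ->
  (forall z, Cmod (C_derive f z) <= M * (1 + Cmod (f z) ^ 2)) ->
  / (1 + Cmod (f a) ^ 2) - / (1 + Cmod (f b) ^ 2) <= M * Cmod (b - a).
Proof.
  intros Hf HM.
  set (A := fun t => fst (f (line a b t))). set (B := fun t => snd (f (line a b t))).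
  set (l := fun t => (C_derive f (line a b t) * (b - a))%C).
  assert (P : forall t, pderiv (fun t => f (line a b t)) t (l t)).
  { intros t. apply pderiv_comp; [|apply pderiv_line]. apply cderiv_correct, Hf. }
  assert (DA : forall t, is_derive A t (fst (l t))) by (intros t; apply (pderiv_fst _ _ _ (P t))).
  assert (DB : forall t, is_derive B t (snd (l t))) by (intros t; apply (pderiv_snd _ _ _ (P t))).
  set (G := fun t => 1 + (A t ^ 2 + B t ^ 2)).
  assert (G0 : forall t, 0 < G t).
  { intros t. unfold G. assert (0 <= A t ^ 2) by apply pow2_ge_0.
    assert (0 <= B t ^ 2) by apply pow2_ge_0. lra. }
  assert (D : forall t, is_derive (fun t => - / G t) t
    (2 * (A t * fst (l t) + B t * snd (l t)) / G t ^ 2)).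
  { intros t.
    assert (EA : ex_derive A t) by exact (ex_intro _ _ (DA t)).
    assert (EB : ex_derive B t) by exact (ex_intro _ _ (DB t)).
    unfold G. auto_derive.
    - repeat split; try easy. apply Rgt_not_eq. specialize (G0 t). unfold G in G0.
      simpl in G0. lra.
    - assert (U1 := is_derive_unique A t _ (DA t)). assert (U2 := is_derive_unique B t _ (DB t)).
      change (Derive (fun x => A x) t) with (Derive A t).
      change (Derive (fun x => B x) t) with (Derive B t).
      rewrite U1, U2. field. specialize (G0 t). unfold G in G0. simpl in G0.
      apply Rgt_not_eq. simpl. lra. }
  destruct (MVT_gen (fun t => - / G t) 0 1
    (fun t => 2 * (A t * fst (l t) + B t * snd (l t)) / G t ^ 2)) as [t [_ Ht]].
  { intros t _. apply D. }
  { intros t _. apply continuity_pt_filterlim.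
    apply (ex_derive_continuous (K := R_AbsRing) (V := R_NormedModule) (fun t => - / G t)).
    exact (ex_intro _ _ (D t)). }
  assert (E0 : G 0 = 1 + Cmod (f a) ^ 2) by (unfold G, A, B; now rewrite line_0, Cmod2_pair).
  assert (E1 : G 1 = 1 + Cmod (f b) ^ 2) by (unfold G, A, B; now rewrite line_1, Cmod2_pair).
  rewrite E0, E1 in Ht.
  replace (/ (1 + Cmod (f a) ^ 2) - / (1 + Cmod (f b) ^ 2)) with
    (- / (1 + Cmod (f b) ^ 2) - - / (1 + Cmod (f a) ^ 2)) by ring.
  rewrite Ht, Rminus_0_r, Rmult_1_r.
  assert (Gt : G t = 1 + Cmod (f (line a b t)) ^ 2) by (unfold G, A, B; now rewrite Cmod2_pair).
  assert (CS : A t * fst (l t) + B t * snd (l t) <= Cmod (f (line a b t)) * Cmod (l t)).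
  { rewrite <- (Cmod_conj (l t)), <- Cmod_mult.
    eapply Rle_trans; [|apply Rle_trans with (2 := re_le_Cmod _); apply Rle_abs].
    apply Req_le. rewrite re_mult, re_conj, im_conj. unfold A, B, Re, Im. ring. }
  replace (Cmod (l t)) with (Cmod (C_derive f (line a b t)) * Cmod (b - a)) in CS
    by (unfold l; now rewrite Cmod_mult).
  apply Rle_div_l; [now apply pow_lt|]. rewrite Gt.
  set (y := Cmod (f (line a b t))) in *.
  assert (y0 : 0 <= y) by apply Cmod_ge_0.
  assert (H := HM (line a b t)). fold y in H.
  assert (d0 := Cmod_ge_0 (b - a)). set (d := Cmod (b - a)) in *.
  assert (H2 : Cmod (C_derive f (line a b t)) * d <= M * (1 + y ^ 2) * d)
    by now apply Rmult_le_compat_r.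
  assert (M0 : 0 <= M * (1 + y ^ 2) * d).
  { apply Rmult_le_pos; [|easy]. eapply Rle_trans; [apply Cmod_ge_0|exact H]. }
  assert (H3 : y * (Cmod (C_derive f (line a b t)) * d) <= y * (M * (1 + y ^ 2) * d))
    by now apply Rmult_le_compat_l.
  replace (M * d * (1 + y ^ 2) ^ 2) with (M * (1 + y ^ 2) * d * (1 + y ^ 2)) by ring.
  assert (H4 : M * (1 + y ^ 2) * d * (2 * y) <= M * (1 + y ^ 2) * d * (1 + y ^ 2)).
  { apply Rmult_le_compat_l; [easy|]. assert (Q := pow2_ge_0 (y - 1)). nra. }
  lra.
Qed.

Lemma exp_ge_1_plus (x : R) : 1 + x <= exp x.
Proof.
  destruct (Req_dec x 0) as [->|N]; [rewrite exp_0; lra|]. apply Rlt_le, exp_ineq1, N.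
Qed.

Lemma Cmod_minus_le (a b : C) : Cmod a - Cmod b <= Cmod (a - b).
Proof.
  assert (T := Cmod_triangle (a - b) b).
  replace (a - b + b)%C with a in T by ring. lra.
Qed.

(** Let rho be the distance from [z0] to the set where |f| <= 1.  A point [w] of that set
    almost at distance rho is compared with the point [z] at depth [e] inside the disc on the same
    ray: Harnack's inequality bounds |f(z)| below, [spherical_segment] bounds it above.  Working
    with an almost nearest [w] dispenses with a compactness argument. *)
Theorem brody_exponential_type (f : C -> C) (M : R) (a z0 : C) : entire f ->
  (forall z, Cmod (C_derive f z) <= M * (1 + Cmod (f z) ^ 2)) ->
  f a = RtoC 0 -> 1 < Cmod (f z0) -> ln (Cmod (f z0)) <= 32 * M * Cmod (a - z0).
Proof.
  intros Hf HM Ha H1.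
  assert (M0 : 0 <= M).
  { assert (H := HM a). rewrite Ha, Cmod_0 in H. assert (P := Cmod_ge_0 (C_derive f a)).
    simpl in H. lra. }
  set (L := ln (Cmod (f z0))).
  assert (L0 : 0 < L) by (rewrite <- ln_1; apply ln_increasing; lra).
  (* rho is an infimum of distances, obtained as the opposite of a supremum *)
  destruct (completeness (fun d => exists w, d = - Cmod (w - z0) /\ Cmod (f w) <= 1))
    as [s [Hs1 Hs2]].
  { exists 0. intros d [w [-> _]]. assert (P := Cmod_ge_0 (w - z0)). lra. }
  { exists (- Cmod (a - z0)), a. split; [easy|]. rewrite Ha, Cmod_0. lra. }
  set (rho := - s).
  assert (I1 : forall w, Cmod (f w) <= 1 -> rho <= Cmod (w - z0)).
  { intros w Hw. unfold rho. assert (H := Hs1 (- Cmod (w - z0)) (ex_intro _ w (conj eq_refl Hw))).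
    lra. }
  assert (I2 : forall e, 0 < e -> exists w, Cmod (f w) <= 1 /\ Cmod (w - z0) < rho + e).
  { intros e He. apply NNPP. intros N.
    assert (B : s <= s - e); [|lra]. apply Hs2. intros d [w [-> Hw]].
    destruct (Rle_dec (- Cmod (w - z0)) (s - e)) as [Y|Y]; [easy|].
    exfalso. apply N. exists w. split; [easy|]. unfold rho. lra. }
  assert (R0 : 0 < rho).
  { assert (Hc := cex_cont f z0 (Hf z0)). rewrite ccont_eps in Hc.
    destruct (Hc (Cmod (f z0) - 1) ltac:(lra)) as [d [d0 Hd]].
    apply Rlt_le_trans with d; [easy|].
    destruct (Rle_dec d rho) as [Y|Y]; [easy|exfalso].
    destruct (I2 (d - rho) ltac:(lra)) as [w [W1 W2]].
    specialize (Hd w ltac:(lra)). rewrite Cmod_swap in Hd.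
    assert (T := Cmod_minus_le (f z0) (f w)). lra. }
  apply Rle_trans with (32 * M * rho).
  2: { apply Rmult_le_compat_l; [lra|]. apply I1. rewrite Ha, Cmod_0. lra. }
  assert (Hh : re_holomorphic (fun z => ln (Cmod (f z))) z0 rho).
  { apply re_holomorphic_ln_Cmod. intros z Hz. split; [apply Hf|].
    intros E. assert (T := I1 z). rewrite E, Cmod_0 in T. specialize (T ltac:(lra)). lra. }
  (* the second bound makes the gain x below at most 2, so that 1/2 - 1/(2+x) >= x/8 *)
  set (e := Rmin (rho / 2) (4 * rho / L)).
  assert (e0 : 0 < e) by (apply Rmin_pos; [lra|]; apply Rdiv_lt_0_compat; lra).
  assert (e1 : e <= rho / 2) by apply Rmin_l.
  assert (e2 : e * L <= 4 * rho) by (apply Rle_div_r; [easy|]; apply Rmin_r).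
  destruct (I2 e e0) as [w [W1 W2]].
  assert (W3 := I1 w W1).
  set (y := Cmod (w - z0)) in *.
  set (z := line z0 w ((rho - e) / y)).
  assert (Z0 : Cmod (z - z0) = rho - e).
  { unfold z, line. replace (z0 + RtoC ((rho - e) / y) * (w - z0) - z0)%C
      with (RtoC ((rho - e) / y) * (w - z0))%C by ring.
    rewrite Cmod_mult, Cmod_R, Rabs_pos_eq.
    - fold y. field. lra.
    - apply Rlt_le, Rdiv_lt_0_compat; lra. }
  assert (Zw : Cmod (z - w) <= 2 * e).
  { replace (z - w)%C with (RtoC ((rho - e) / y - 1) * (w - z0))%C
      by (unfold z, line; rewrite RtoC_minus; ring).
    rewrite Cmod_mult, Cmod_R. fold y.
    replace ((rho - e) / y - 1) with (- ((y - rho + e) / y)) by (field; lra).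
    rewrite Rabs_Ropp, Rabs_pos_eq.
    - replace ((y - rho + e) / y * y) with (y - rho + e) by (field; lra). lra.
    - apply Rlt_le, Rdiv_lt_0_compat; lra. }
  assert (Big : L * e / (4 * rho) <= ln (Cmod (f z))).
  { assert (Hk := harnack _ z0 z (rho - e / 2) rho Hh ltac:(lra) ltac:(lra)).
    cbv beta in Hk. fold L in Hk. rewrite Z0 in Hk.
    eapply Rle_trans; [|apply Hk].
    - replace ((rho - e / 2 - (rho - e)) / (rho - e / 2 + (rho - e)) * L)
        with ((L * e) / (4 * rho - 3 * e)) by (field; lra).
      unfold Rdiv. apply Rmult_le_compat_l; [nra|]. apply Rinv_le_contravar; lra.
    - intros t. rewrite <- ln_1. apply ln_le; [lra|].
      destruct (Rle_dec (Cmod (f (circle_pt z0 (rho - e / 2) t))) 1) as [Y|Y]; [|lra].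
      assert (T := I1 _ Y). rewrite Cmod_circle_pt in T; lra. }
  assert (fz : 0 < Cmod (f z)).
  { destruct (Rle_dec (Cmod (f z)) 1) as [Y|Y]; [|lra]. assert (T := I1 _ Y). lra. }
  set (x := L * e / (2 * rho)).
  assert (x0 : 0 < x) by (apply Rdiv_lt_0_compat; [now apply Rmult_lt_0_compat|lra]).
  assert (x2 : x <= 2) by (apply Rle_div_l; [lra|rewrite (Rmult_comm L); lra]).
  assert (Gz : 1 + x <= Cmod (f z) ^ 2).
  { rewrite <- (exp_ln _ fz).
    eapply Rle_trans; [apply (exp_ge_1_plus x)|].
    replace (exp (ln (Cmod (f z))) ^ 2) with (exp (ln (Cmod (f z)) + ln (Cmod (f z))))
      by (rewrite exp_plus; ring).
    assert (X : x <= ln (Cmod (f z)) + ln (Cmod (f z))).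
    { unfold x. replace (L * e / (2 * rho)) with (L * e / (4 * rho) + L * e / (4 * rho))
        by (field; lra). lra. }
    destruct X as [X|X]; [now apply Rlt_le, exp_increasing|rewrite X; lra]. }
  assert (Sp := spherical_segment f M w z Hf HM).
  assert (Gw : Cmod (f w) ^ 2 <= 1).
  { assert (P := Cmod_ge_0 (f w)). nra. }
  assert (A1 : / 2 <= / (1 + Cmod (f w) ^ 2)).
  { apply Rinv_le_contravar; [|lra]. assert (P := pow2_ge_0 (Cmod (f w))). lra. }
  assert (A2 : / (1 + Cmod (f z) ^ 2) <= / (2 + x)) by (apply Rinv_le_contravar; lra).
  assert (A3 : x / 8 <= / 2 - / (2 + x)).
  { replace (/ 2 - / (2 + x)) with (x / (2 * (2 + x))) by (field; lra).
    unfold Rdiv. apply Rmult_le_compat_l; [lra|]. apply Rinv_le_contravar; lra. }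
  assert (A4 : M * Cmod (z - w) <= M * (2 * e)) by now apply Rmult_le_compat_l.
  assert (A5 : x <= 16 * M * e) by lra.
  unfold x in A5. replace (L * e / (2 * rho)) with (L / (2 * rho) * e) in A5 by (field; lra).
  apply Rmult_le_reg_r in A5; [|easy]. assert (A6 : L <= 16 * M * (2 * rho)) by (apply Rle_div_l; lra). lra.
Qed.

(** * The divisor of a lacunary symmetric sequence *)

Definition lacunary (x : nat -> R) : Prop :=
  (forall n, 1 <= x n) /\ (forall n, 4 * x n ^ 2 <= x (S n)).

Definition symmetric_points (x : nat -> R) (z : C) : Prop :=
  exists k, z = RtoC (x k) \/ z = RtoC (- x k).

Lemma lacunary_lt (x : nat -> R) (i j : nat) : lacunary x -> (i < j)%nat -> 4 * x i <= x j.
Proof.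
  intros [H1 H4] Hij. induction Hij as [|j Hij IH].
  - specialize (H1 i). specialize (H4 i). nra.
  - specialize (H4 j). assert (A := H1 j). assert (B := H1 i). nra.
Qed.

Lemma lacunary_inj (x : nat -> R) (i j : nat) : lacunary x -> x i = x j -> i = j.
Proof.
  intros H E. assert (Hi := proj1 H i). assert (Hj := proj1 H j).
  destruct (Nat.lt_trichotomy i j) as [L|[L|L]]; [|easy|];
    apply (lacunary_lt x) in L; try easy; lra.
Qed.

Lemma lacunary_ge (x : nat -> R) (n : nat) : lacunary x -> INR n <= x n.
Proof.
  intros [H1 H4]. induction n as [|n IH].
  - specialize (H1 O). simpl. lra.
  - rewrite S_INR. specialize (H1 n). specialize (H4 n). nra.
Qed.

(** An initial segment of the indices, since [x] is increasing and unbounded. *)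
Lemma lacunary_count (x : nat -> R) (r : R) : lacunary x ->
  exists N, forall k, x k < r <-> (k < N)%nat.
Proof.
  intros H.
  assert (A : forall n, r <= x n -> exists N, forall k, x k < r <-> (k < N)%nat).
  { intros n. induction n as [|n IH]; intros Hn.
    - exists O. intros k. split; [|lia]. intros Hk.
      destruct k as [|k]; [lra|]. assert (L := lacunary_lt x 0 (S k) H ltac:(lia)).
      assert (P := proj1 H O). lra.
    - destruct (Rle_dec r (x n)) as [Y|Y]; [now apply IH|].
      exists (S n). intros k. split; intros Hk.
      + destruct (Nat.lt_ge_cases k (S n)) as [L|L]; [easy|exfalso].
        destruct (proj1 (Nat.lt_eq_cases (S n) k) L) as [L'|L']; [|subst; lra].
        apply (lacunary_lt x) in L'; [|easy]. assert (P := proj1 H (S n)). lra.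
      + destruct (proj1 (Nat.lt_eq_cases k n) ltac:(lia)) as [L'|L']; [|subst; lra].
        apply (lacunary_lt x) in L'; [|easy]. assert (P := proj1 H k). lra. }
  destruct (INR_unbounded r) as [n Hn]. apply (A n).
  assert (G := lacunary_ge x n H). lra.
Qed.

Lemma symmetric_points_separated (x : nat -> R) (z w : C) : lacunary x ->
  symmetric_points x z -> symmetric_points x w -> Cmod (w - z) < 1 -> w = z.
Proof.
  intros H [i Hi] [j Hj] Hd.
  assert (Pi := proj1 H i). assert (Pj := proj1 H j).
  assert (S : forall a b : R, RtoC a = z -> RtoC b = w -> Rabs (b - a) < 1).
  { intros a b <- <-. now rewrite <- RtoC_minus, Cmod_R in Hd. }
  destruct (Nat.lt_trichotomy i j) as [L|[L|L]].
  - apply (lacunary_lt x) in L; [|easy].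
    destruct Hi as [Ei|Ei], Hj as [Ej|Ej]; specialize (S _ _ (eq_sym Ei) (eq_sym Ej));
      apply Rabs_lt_between in S; lra.
  - subst j. destruct Hi as [Ei|Ei], Hj as [Ej|Ej]; specialize (S _ _ (eq_sym Ei) (eq_sym Ej));
      apply Rabs_lt_between in S; try lra; congruence.
  - apply (lacunary_lt x) in L; [|easy].
    destruct Hi as [Ei|Ei], Hj as [Ej|Ej]; specialize (S _ _ (eq_sym Ei) (eq_sym Ej));
      apply Rabs_lt_between in S; lra.
Qed.

Lemma symmetric_points_divisor (x : nat -> R) : lacunary x ->
  reduced_divisor (symmetric_points x).
Proof.
  intros H. split.
  - intros z Hz. apply NNPP. intros Nz. apply Hz. apply locally_Cmod.
    destruct (classic (exists p, symmetric_points x p /\ Cmod (p - z) < 1 / 2)) as [[p [Dp Hp]]|N].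
    + assert (P : 0 < Cmod (p - z)).
      { apply Cmod_gt_0, Cminus_eq_contra. intros ->. easy. }
      exists (Cmod (p - z)). split; [easy|]. intros w Hw Dw.
      assert (E : w = p); [|subst; lra].
      apply (symmetric_points_separated x); try easy.
      assert (T := Cmod_triangle (w - z) (z - p)).
      replace (w - z + (z - p))%C with (w - p)%C in T by ring.
      rewrite (Cmod_swap z p) in T. lra.
    + exists (1 / 2). split; [lra|]. intros w Hw Dw. apply N. now exists w.
  - intros z Dz. exists 1. split; [lra|]. intros w Dw.
    now apply (symmetric_points_separated x).
Qed.

Lemma symmetric_points_degree (x : nat -> R) (r : R) (N : nat) : lacunary x ->
  (forall k, x k < r <-> (k < N)%nat) -> degree (symmetric_points x) r (2 * N).
Proof.
  intros H HN.
  exists (map (fun k => RtoC (x k)) (seq 0 N) ++ map (fun k => RtoC (- x k)) (seq 0 N)).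
  split; [|split].
  - apply NoDup_app.
    + apply NoDup_map_NoDup_ForallPairs; [|apply seq_NoDup].
      intros i j _ _ E. apply RtoC_inj in E. now apply (lacunary_inj x).
    + apply NoDup_map_NoDup_ForallPairs; [|apply seq_NoDup].
      intros i j _ _ E. apply RtoC_inj in E. apply (lacunary_inj x); [easy|lra].
    + intros z H1 H2. apply in_map_iff in H1 as [i [<- _]].
      apply in_map_iff in H2 as [j [E _]]. apply RtoC_inj in E.
      assert (Pi := proj1 H i). assert (Pj := proj1 H j). lra.
  - rewrite length_app, !length_map, length_seq. lia.
  - intros z. rewrite in_app_iff, !in_map_iff. split.
    + intros [[k [<- Hk]]|[k [<- Hk]]]; apply in_seq in Hk; assert (P := proj1 H k);
        (split; [exists k; auto|]); rewrite Cmod_R, ?Rabs_Ropp, Rabs_pos_eq by lra;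
        apply HN; lia.
    + intros [[k [->| ->]] Hk]; assert (P := proj1 H k);
        rewrite Cmod_R, ?Rabs_Ropp, Rabs_pos_eq in Hk by lra; apply HN in Hk.
      * left. exists k. split; [easy|]. apply in_seq. lia.
      * right. exists k. split; [easy|]. apply in_seq. lia.
Qed.

(** The factors are normalised to be 1 at 0, so that dividing by the product does not
    change the value at 0. *)
Fixpoint even_prod (x : nat -> R) (n : nat) (z : C) : C :=
  match n with
  | O => RtoC 1
  | S n => (even_prod x n z * (1 - z * z / RtoC (x n ^ 2)))%C
  end.

Lemma even_prod_S (x : nat -> R) (n : nat) (z : C) :
  even_prod x (S n) z = (even_prod x n z * (1 - z * z / RtoC (x n ^ 2)))%C.
Proof. reflexivity. Qed.

Lemma cderiv_even_factor (z k : C) : cderiv (fun z => 1 - z * z / k)%C z (- (2 * z / k))%C.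
Proof.
  apply (cderiv_eq _ _ (RtoC 0 - ((1 * z + z * 1) * / k + z * z * 0))%C); [|unfold Cdiv; ring].
  apply (cderiv_minus (fun _ => RtoC 1) (fun z => z * z / k)%C); [apply cderiv_const|].
  apply (cderiv_mult (fun z => z * z)%C (fun _ => / k)%C); [|apply cderiv_const].
  apply (cderiv_mult (fun z => z) (fun z => z)); apply cderiv_id.
Qed.

Lemma entire_even_prod (x : nat -> R) (n : nat) : entire (even_prod x n).
Proof.
  intros z. induction n as [|n [l IH]]; simpl.
  - exists (RtoC 0). apply cderiv_const.
  - exact (ex_intro _ _ (cderiv_mult _ _ z _ _ IH (cderiv_even_factor z _))).
Qed.

Lemma even_prod_0 (x : nat -> R) (n : nat) : even_prod x n 0 = RtoC 1.
Proof. induction n as [|n IH]; simpl; [easy|]. rewrite IH. unfold Cdiv. ring. Qed.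

Lemma even_prod_root (x : nat -> R) (n k : nat) (z : C) : x k <> 0 -> (k < n)%nat ->
  (z * z)%C = RtoC (x k ^ 2) -> even_prod x n z = RtoC 0.
Proof.
  intros Hx Hk Hz. induction Hk as [|n Hk IH].
  - simpl even_prod. rewrite Hz. unfold Cdiv. rewrite Cinv_r; [ring|].
    intros E. apply RtoC_inj in E. now apply (pow_nonzero (x k) 2 Hx).
  - simpl. rewrite IH. ring.
Qed.

Lemma Cmod_even_factor (z : C) (y : R) : 0 < y ->
  Cmod z ^ 2 / y ^ 2 - 1 <= Cmod (1 - z * z / RtoC (y ^ 2)).
Proof.
  intros Hy. assert (Q : 0 < y ^ 2) by now apply pow_lt.
  assert (T := Cmod_minus_le (z * z / RtoC (y ^ 2)) 1).
  assert (N : RtoC (y ^ 2) <> RtoC 0) by (intros E; apply RtoC_inj in E; lra).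
  rewrite (Cmod_swap (_ / _)), Cmod_1, (Cmod_div _ _ N), Cmod_mult, Cmod_R, Rabs_pos_eq in T
    by lra.
  replace (Cmod z ^ 2) with (Cmod z * Cmod z) by ring. exact T.
Qed.

(** Each factor has modulus at least 1 where |z|^2 >= 2 x_k^2, and the factor of index 0
    gives quadratic growth. *)
Lemma even_prod_large (x : nat -> R) (n : nat) (z : C) : (forall k, 0 < x k) ->
  (forall k, (k <= n)%nat -> 2 * x k ^ 2 <= Cmod z ^ 2) ->
  Cmod z ^ 2 / (2 * x O ^ 2) <= Cmod (even_prod x (S n) z).
Proof.
  intros Hx Hz.
  assert (Q : forall k, 0 < x k ^ 2) by (intros; now apply pow_lt).
  induction n as [|n IH].
  - simpl even_prod. rewrite Cmult_1_l. eapply Rle_trans; [|now apply Cmod_even_factor].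
    assert (B : 2 <= Cmod z ^ 2 / x O ^ 2) by (apply Rle_div_r; [apply Q|apply Hz; lia]).
    replace (Cmod z ^ 2 / (2 * x O ^ 2)) with (Cmod z ^ 2 / x O ^ 2 / 2)
      by (field; apply Rgt_not_eq, Hx). lra.
  - rewrite even_prod_S, Cmod_mult. specialize (IH (fun k Hk => Hz k ltac:(lia))).
    assert (F := Cmod_even_factor z (x (S n)) (Hx _)).
    assert (B : 2 <= Cmod z ^ 2 / x (S n) ^ 2) by (apply Rle_div_r; [apply Q|apply Hz; lia]).
    assert (P := Cmod_ge_0 (even_prod x (S n) z)). nra.
Qed.

Lemma entire_Cmult_const (k : C) (f : C -> C) : entire f -> entire (fun z => k * f z)%C.
Proof.
  intros Hf z. destruct (Hf z) as [l Hl]. exact (ex_intro _ _ (cderiv_scal k f z l Hl)).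
Qed.

Lemma entire_even_factor (f : C -> C) (x : nat -> R) (n : nat) : lacunary x -> entire f ->
  (forall z, symmetric_points x z -> f z = RtoC 0) ->
  exists q, entire q /\ forall z, f z = (even_prod x n z * q z)%C.
Proof.
  intros H Hf H0. induction n as [|n [q [Hq Eq]]].
  - exists f. split; [easy|]. intros z. simpl. ring.
  - assert (x1 := proj1 H n).
    assert (xn : RtoC (x n) <> RtoC 0) by (intros E; apply RtoC_inj in E; lra).
    assert (Z : forall y : R, y ^ 2 = x n ^ 2 -> symmetric_points x (RtoC y) -> q y = RtoC 0).
    { intros y Ey Dy. assert (E := Eq y). rewrite H0 in E by easy.
      destruct (Ceq_dec (q y) 0) as [Y|Y]; [easy|exfalso].
      assert (P : even_prod x n y <> RtoC 0).
      { destruct n as [|n]; [simpl; intros E'; apply RtoC_inj in E'; lra|].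
        apply Cmod_gt_0. eapply Rlt_le_trans; [|apply even_prod_large].
        - apply Rdiv_lt_0_compat.
          + rewrite Cmod_R, RPow_abs, Ey, Rabs_pos_eq by apply pow2_ge_0. apply pow_lt; lra.
          + assert (A := proj1 H O). assert (0 < x O ^ 2) by (apply pow_lt; lra). lra.
        - intros k. assert (A := proj1 H k). lra.
        - intros k Hk. rewrite Cmod_R, RPow_abs, Ey, Rabs_pos_eq by apply pow2_ge_0.
          assert (A := proj1 H k). assert (L := lacunary_lt x k (S n) H ltac:(lia)). nra. }
      exact (Cmult_neq_0 _ _ P Y (eq_sym E)). }
    destruct (entire_factor q (x n) Hq) as [q1 [Hq1 Eq1]].
    { apply Z; [easy|]. exists n. auto. }
    destruct (entire_factor q1 (RtoC (- x n)) Hq1) as [q2 [Hq2 Eq2]].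
    { assert (E := Eq1 (RtoC (- x n))). rewrite Z in E.
      - destruct (Ceq_dec (q1 (RtoC (- x n))) 0) as [Y|Y]; [easy|exfalso].
        refine (Cmult_neq_0 _ _ _ Y (eq_sym E)). rewrite <- RtoC_minus.
        intros E'. apply RtoC_inj in E'. lra.
      - ring.
      - exists n. auto. }
    exists (fun z => RtoC (- x n ^ 2) * q2 z)%C. split; [now apply entire_Cmult_const|].
    intros z. rewrite Eq, Eq1, Eq2, even_prod_S.
    rewrite !RtoC_opp, RtoC_pow. field. exact xn.
Qed.

(** * No Brody function has that divisor *)

Lemma symmetric_points_sqr (x : nat -> R) (z : C) : symmetric_points x z ->
  exists k, (z * z)%C = RtoC (x k ^ 2) /\ Cmod z = Rabs (x k).
Proof.
  intros [k [->| ->]]; exists k; rewrite <- RtoC_mult, Cmod_R, ?Rabs_Ropp; split; try easy;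
    f_equal; ring.
Qed.

(** A zero of [q] in the disc would be a zero of [f], hence also of the product, so a
    multiple zero of [f]; but the zeros of [f] are simple. *)
Lemma quotient_neq_0 (f q : C -> C) (x : nat -> R) (n : nat) (z : C) : lacunary x ->
  entire q -> is_zero_divisor f (symmetric_points x) ->
  (forall z, f z = (even_prod x n z * q z)%C) -> Cmod z < x n -> q z <> RtoC 0.
Proof.
  intros H Hq Hd Ef Hz Eq.
  assert (f0 : f z = RtoC 0) by (rewrite Ef, Eq; ring).
  destruct (classic (symmetric_points x z)) as [Dz|Dz].
  2: { destruct (proj2 (Hd z) Dz) as [_ Y]. exact (Y f0). }
  destruct (proj1 (Hd z) Dz) as [_ Y]. apply Y.
  destruct (symmetric_points_sqr x z Dz) as [k [Ek Ak]].
  assert (xk := proj1 H k). rewrite Rabs_pos_eq in Ak by lra.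
  assert (Hk : (k < n)%nat).
  { destruct (Nat.lt_ge_cases k n) as [L|L]; [easy|exfalso].
    destruct (proj1 (Nat.lt_eq_cases n k) L) as [L'|L']; [|subst; lra].
    apply (lacunary_lt x) in L'; [|easy]. assert (P := proj1 H n). lra. }
  change (C_derive f z = RtoC 0). apply is_C_derive_unique.
  destruct (entire_even_prod x n z) as [p Hp]. destruct (Hq z) as [l Hl].
  apply (is_derive_ext (K := C_AbsRing) (V := C_NormedModule) (fun z => even_prod x n z * q z)%C).
  { intros w. symmetry. apply Ef. }
  apply (cderiv_eq _ _ _ _ (cderiv_mult _ _ z _ _ Hp Hl)).
  rewrite Eq, (even_prod_root x n k z) by (easy || lra). ring.
Qed.

Lemma C_derive_at_root (f q : C -> C) (x : nat -> R) (n : nat) (y : R) :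
  entire q -> y <> 0 -> y ^ 2 = x n ^ 2 ->
  (forall z, f z = (even_prod x (S n) z * q z)%C) ->
  Cmod (C_derive f y) = 2 * (Cmod (even_prod x n y) * Cmod (q y)) / Rabs y.
Proof.
  intros Hq y0 Ey Ef.
  assert (Y0 : RtoC y <> RtoC 0) by (intros E; now apply RtoC_inj in E).
  assert (E : C_derive f y = (- (2 * (even_prod x n y * q y) / y))%C).
  { apply is_C_derive_unique.
    destruct (entire_even_prod x n y) as [p Hp]. destruct (Hq y) as [l Hl].
    apply (is_derive_ext (K := C_AbsRing) (V := C_NormedModule)
      (fun z => even_prod x n z * q z * (1 - z * z / RtoC (x n ^ 2)))%C).
    { intros w. rewrite Ef, even_prod_S. change (@eq C
        (even_prod x n w * q w * (1 - w * w / (x n ^ 2)%R))%C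
        (even_prod x n w * (1 - w * w / (x n ^ 2)%R) * q w)%C). ring. }
    apply (cderiv_eq _ _ _ _ (cderiv_mult _ _ _ _ _ (cderiv_mult _ _ _ _ _ Hp Hl)
      (cderiv_even_factor _ _))).
    rewrite <- Ey, RtoC_pow. field. exact Y0. }
  rewrite E, Cmod_opp, Cmod_div, !Cmod_mult, !Cmod_R, (Rabs_pos_eq 2) by (easy || lra).
  easy.
Qed.

(** [harnack_symmetric] for B - ln |q| on the circle of radius r = x_(n+1)/2, where
    B = 64 M r >= ln |f| >= ln |q| by the exponential type of [f].  The correction [k] is O(1/r),
    so [k * B] is bounded. *)
Lemma quotient_lower_bound (f q : C -> C) (x : nat -> R) (M : R) (n : nat) :
  lacunary x -> entire f -> (forall z, Cmod (C_derive f z) <= M * (1 + Cmod (f z) ^ 2)) ->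
  is_zero_divisor f (symmetric_points x) -> entire q ->
  (forall z, f z = (even_prod x (S n) z * q z)%C) ->
  let c := ln (Cmod (f 0)) in
  2 * c - 256 * M - 4 * Rabs c <= ln (Cmod (q (x n))) + ln (Cmod (q (- x n)%C)).
Proof.
  intros H Hf HM Hd Hq Ef c.
  assert (xn := proj1 H n). assert (xS := proj2 H n). assert (xS1 := proj1 H (S n)).
  set (r := x (S n) / 2).
  assert (r2 : 2 * x n ^ 2 <= r) by (unfold r; lra).
  assert (rx : 2 * x n <= r) by nra.
  assert (fx0 : f (x O) = RtoC 0).
  { destruct (proj1 (Hd (x O))) as [Y _]; [exists O; auto|]. exact (Y O (Nat.lt_0_1)). }
  assert (M0 : 0 <= M).
  { assert (T := HM (x O)). rewrite fx0, Cmod_0 in T.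
    assert (P := Cmod_ge_0 (C_derive f (x O))). simpl in T. lra. }
  assert (q0 : f 0 = q 0) by (rewrite Ef, even_prod_0; ring).
  assert (NV : forall z, Cmod z < x (S n) -> q z <> RtoC 0).
  { intros z Hz. apply (quotient_neq_0 f q x (S n) z); try easy. }
  set (B := 64 * M * r).
  assert (Hh : re_holomorphic (fun z => B - ln (Cmod (q z))) 0 (x (S n))).
  { apply (re_holomorphic_const_minus (fun z => ln (Cmod (q z)))), re_holomorphic_ln_Cmod.
    intros z Hz. replace (z - 0)%C with z in Hz by ring. split; [apply Hq|now apply NV]. }
  assert (Pos : forall t, 0 <= B - ln (Cmod (q (circle_pt 0 r t)))).
  { intros t. set (w := circle_pt 0 r t).
    assert (Cw : Cmod w = r).
    { rewrite <- (Cmod_circle_pt 0 r t) by lra. fold w. f_equal. ring. }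
    assert (Pw : 1 <= Cmod (even_prod x (S n) w)).
    { eapply Rle_trans; [|apply even_prod_large].
      - assert (A := proj1 H O). assert (x O <= x n).
        { destruct n as [|k]; [lra|]. assert (L := lacunary_lt x O (S k) H ltac:(lia)). lra. }
        rewrite Cw. apply Rle_div_r; nra.
      - intros k. assert (A := proj1 H k). lra.
      - intros k Hk. rewrite Cw. assert (A := proj1 H k). assert (x k <= x n).
        { destruct (proj1 (Nat.lt_eq_cases k n) Hk) as [L|L]; [|subst; lra].
          apply (lacunary_lt x) in L; [lra|easy]. }
        assert (x k ^ 2 <= x n ^ 2) by (apply pow_incr; lra).
        assert ((2 * x n) ^ 2 <= r ^ 2) by (apply pow_incr; lra).
        assert (0 <= x n ^ 2) by apply pow2_ge_0. lra. }
    assert (qw : 0 < Cmod (q w)) by (apply Cmod_gt_0, NV; rewrite Cw; unfold r; lra).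
    assert (Le : Cmod (q w) <= Cmod (f w)).
    { rewrite Ef, Cmod_mult. nra. }
    assert (LL : ln (Cmod (q w)) <= ln (Cmod (f w))) by now apply ln_le.
    assert (Bd : ln (Cmod (f w)) <= B).
    { destruct (Rle_dec (Cmod (f w)) 1) as [Y|Y].
      - apply Rle_trans with 0; [|unfold B; repeat apply Rmult_le_pos; lra].
        rewrite <- ln_1. apply ln_le; lra.
      - eapply Rle_trans; [apply (brody_exponential_type f M (x O) w); auto; lra|].
        assert (T := Cmod_triangle (x O) (- w)). rewrite Cmod_opp, Cw, Cmod_R in T.
        assert (A := proj1 H O). rewrite Rabs_pos_eq in T by lra.
        assert (x O <= x n).
        { destruct n as [|k]; [lra|]. assert (L := lacunary_lt x O (S k) H ltac:(lia)). lra. }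
        unfold B. replace (64 * M * r) with (32 * M * (2 * r)) by ring.
        apply Rmult_le_compat_l; [lra|]. unfold Cminus. lra. }
    lra. }
  assert (Cx : Cmod (x n) = x n) by (rewrite Cmod_R, Rabs_pos_eq; lra).
  assert (HS := harnack_symmetric _ (x n) r (x (S n)) Hh).
  rewrite Cx in HS. specialize (HS ltac:(lra) ltac:(unfold r; lra) Pos). cbv beta in HS.
  rewrite <- q0 in HS. fold c in HS.
  set (k := 2 * x n ^ 2 / (r ^ 2 - x n ^ 2)).
  assert (D0 : 0 < r ^ 2 - x n ^ 2) by nra.
  assert (K : 2 * (r ^ 2 + x n ^ 2) / (r ^ 2 - x n ^ 2) = 2 * (1 + k)) by (unfold k; field; lra).
  assert (k0 : 0 <= k).
  { apply Rlt_le, Rdiv_lt_0_compat; [|easy]. assert (0 < x n ^ 2) by (apply pow_lt; lra). lra. }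
  assert (kr : k * r <= 2).
  { unfold k. replace (2 * x n ^ 2 / (r ^ 2 - x n ^ 2) * r)
      with ((2 * x n ^ 2 * r) / (r ^ 2 - x n ^ 2)) by (field; lra).
    apply Rle_div_l; [easy|]. nra. }
  assert (k2 : k <= 1) by nra.
  rewrite K in HS.
  assert (kB : k * B <= 128 * M).
  { unfold B. replace (k * (64 * M * r)) with (64 * M * (k * r)) by ring.
    replace (128 * M) with (64 * M * 2) by ring. apply Rmult_le_compat_l; lra. }
  assert (kc : - Rabs c <= k * c).
  { assert (A1 := Rabs_pos c). assert (A2 := Rle_abs (- c)). rewrite Rabs_Ropp in A2.
    assert (k * - c <= k * Rabs c) by now apply Rmult_le_compat_l.
    assert (k * Rabs c <= 1 * Rabs c) by now apply Rmult_le_compat_r. lra. }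
  assert (A1 := Rabs_pos c). lra.
Qed.

(** At the zeros x_n and -x_n the derivative of [f] is at most [M], which forces
    |q(x_n)| and |q(-x_n)| below M x_0^2 / x_n, against [quotient_lower_bound] for large n. *)
Theorem symmetric_points_not_brody (x : nat -> R) : lacunary x ->
  ~ exists f, entire f /\ brody f /\ is_zero_divisor f (symmetric_points x).
Proof.
  intros H [f [Hf [[M HM'] Hd]]].
  assert (HM : forall z, Cmod (C_derive f z) <= M * (1 + Cmod (f z) ^ 2)).
  { intros z. specialize (HM' z). unfold spherical_derivative in HM'.
    apply Rle_div_l in HM'; [easy|]. assert (P := pow2_ge_0 (Cmod (f z))). lra. }
  assert (Hz : forall z, symmetric_points x z -> f z = RtoC 0).
  { intros z Dz. destruct (proj1 (Hd z) Dz) as [Y _]. exact (Y O Nat.lt_0_1). }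
  assert (x0 := proj1 H O).
  set (c := ln (Cmod (f 0))). set (K := 2 * c - 256 * M - 4 * Rabs c).
  destruct (INR_unbounded (M * x O ^ 2 * exp (- K / 2))) as [m Hm].
  set (n := S m).
  destruct (entire_even_factor f x (S n) H Hf Hz) as [q [Hq Ef]].
  assert (LB := quotient_lower_bound f q x M n H Hf HM Hd Hq Ef). cbv zeta in LB.
  fold c K in LB.
  assert (xn := proj1 H n).
  assert (UB : forall y, y ^ 2 = x n ^ 2 -> symmetric_points x y -> Rabs y = x n ->
    0 < Cmod (q y) <= M * x O ^ 2 / x n).
  { intros y Ey Dy Ay.
    assert (y0 : y <> 0) by (intros ->; rewrite Rabs_R0 in Ay; lra).
    assert (D := C_derive_at_root f q x n y Hq y0 Ey Ef).
    assert (U := HM y). rewrite (Hz y Dy), Cmod_0, D, Ay in U.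
    assert (P : x n ^ 2 / (2 * x O ^ 2) <= Cmod (even_prod x n y)).
    { rewrite <- Ay, <- (Cmod_R y). apply even_prod_large.
      - intros k. assert (A := proj1 H k). lra.
      - intros k Hk. rewrite Cmod_R, Ay. assert (A := proj1 H k).
        assert (L := lacunary_lt x k n H ltac:(unfold n; lia)). nra. }
    assert (Q : 0 < Cmod (q y)).
    { apply Cmod_gt_0, (quotient_neq_0 f q x (S n)); try easy.
      rewrite Cmod_R, Ay. assert (L := lacunary_lt x n (S n) H ltac:(lia)). lra. }
    split; [easy|].
    assert (U' : 2 * (Cmod (even_prod x n y) * Cmod (q y)) <= M * x n).
    { apply Rle_div_l; [lra|]. replace (M * (1 + 0 ^ 2)) with M in U by ring. exact U. }
    assert (U2 : x n ^ 2 / (2 * x O ^ 2) * Cmod (q y) <= M * x n / 2).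
    { apply Rle_trans with (Cmod (even_prod x n y) * Cmod (q y)); [|lra].
      apply Rmult_le_compat_r; lra. }
    apply Rle_div_r; [lra|].
    apply Rmult_le_reg_l with (x n / (2 * x O ^ 2)).
    { apply Rdiv_lt_0_compat; [lra|]. assert (0 < x O ^ 2) by (apply pow_lt; lra). lra. }
    eapply Rle_trans; [|eapply Rle_trans; [exact U2|]]; apply Req_le; field; lra. }
  assert (U1 := UB (x n) eq_refl (ex_intro _ n (or_introl eq_refl)) ltac:(apply Rabs_pos_eq; lra)).
  assert (U2 := UB (- x n) ltac:(ring) (ex_intro _ n (or_intror eq_refl))
    ltac:(rewrite Rabs_Ropp; apply Rabs_pos_eq; lra)).
  rewrite RtoC_opp in U2.
  assert (L1 := ln_le _ _ (proj1 U1) (proj2 U1)). assert (L2 := ln_le _ _ (proj1 U2) (proj2 U2)).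
  assert (L : K / 2 <= ln (M * x O ^ 2 / x n)) by lra.
  assert (Mp : 0 < M * x O ^ 2 / x n) by lra.
  assert (E : exp (K / 2) <= M * x O ^ 2 / x n).
  { rewrite <- (exp_ln _ Mp). destruct L as [L|L]; [now apply Rlt_le, exp_increasing|rewrite L; lra]. }
  apply Rle_div_r in E; [|lra].
  assert (G := lacunary_ge x n H). unfold n in G at 1. rewrite S_INR in G.
  replace (- K / 2) with (- (K / 2)) in Hm by field. rewrite exp_Ropp in Hm.
  assert (e0 := exp_pos (K / 2)).
  assert (E2 : M * x O ^ 2 < INR m * exp (K / 2)).
  { apply Rlt_div_l; [easy|]. unfold Rdiv. lra. }
  nra.
Qed.

(** Choose each x_n beyond two thresholds, one from the previous point and one from
    the unboundedness of [zeta]. *)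
Lemma lacunary_exists (zeta : R -> R) :
  (forall r s, 0 < r -> r <= s -> zeta r <= zeta s) ->
  (forall M, exists r, 0 < r /\ M < zeta r) ->
  exists x, lacunary x /\ forall n, INR (2 * S n) <= zeta (x n).
Proof.
  intros Hm Hu.
  assert (N : forall a : R * R, exists r, 1 <= r /\ fst a <= r /\ snd a <= zeta r).
  { intros [a b]. destruct (Hu b) as [r [r0 Hr]].
    exists (Rmax r (Rmax 1 a)).
    assert (M1 := Rmax_l r (Rmax 1 a)). assert (M2 := Rmax_r r (Rmax 1 a)).
    assert (M3 := Rmax_l 1 a). assert (M4 := Rmax_r 1 a). simpl.
    specialize (Hm r _ r0 M1). lra. }
  set (next := fun a b => proj1_sig (constructive_indefinite_description _ (N (a, b)))).
  assert (Hn : forall a b, 1 <= next a b /\ a <= next a b /\ b <= zeta (next a b)).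
  { intros a b. exact (proj2_sig (constructive_indefinite_description _ (N (a, b)))). }
  set (x := fix x n := match n with
    | O => next 1 2
    | S n => next (4 * x n ^ 2) (INR (2 * S (S n)))
    end).
  exists x. split; [split|].
  - intros [|n]; apply Hn.
  - intros n. apply Hn.
  - intros [|n]; simpl x.
    + eapply Rle_trans; [|apply Hn]. simpl. lra.
    + apply Hn.
Qed.

Theorem corollary4 (zeta : R -> R)
  (zeta_pos : forall r : R, 0 < r -> 0 < zeta r)
  (zeta_mono : forall r s : R, 0 < r -> r <= s -> zeta r <= zeta s)
  (zeta_unbounded : forall M : R, exists r : R, 0 < r /\ M < zeta r) :
  exists D : C -> Prop,
    reduced_divisor D /\
    (forall r : R, 0 < r -> exists n : nat, degree D r n /\ INR n <= zeta r) /\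
    ~ (exists f : C -> C, entire f /\ brody f /\ is_zero_divisor f D).
Proof.
  destruct (lacunary_exists zeta zeta_mono zeta_unbounded) as [x [H Hx]].
  exists (symmetric_points x). split; [now apply symmetric_points_divisor|].
  split; [|now apply symmetric_points_not_brody].
  intros r r0. destruct (lacunary_count x r H) as [N HN].
  exists (2 * N)%nat. split; [now apply symmetric_points_degree|].
  destruct N as [|n].
  - specialize (zeta_pos r r0). simpl. lra.
  - eapply Rle_trans; [apply Hx|]. assert (L := proj2 (HN n) (Nat.lt_succ_diag_r n)).
    apply zeta_mono; [|lra]. assert (P := proj1 H n). lra.
Qed.
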